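(* Let $P\in\mathbb{C}[z]$ be a polynomial with $|P(0)|=1$, $\|P\|_0<e$, and $Z(P)\geq 1$. Then \[ \frac{\log^2 M(P)}{Z(P)} \leq \log\|P\|_0\left(1+\sum_{k=1}^\infty\left(\sum_{\ell=1}^{k+1}\frac{1}{\ell(k+2-\ell)}-\frac{1}{k+2}\right)\left(\log\|P\|_0\right)^{k/2}\right), \] where $\log^2 M(P)=(\log M(P))^2$.
   Context: For a nonzero polynomial $P\in\mathbb{C}[z]$, the (logarithmic) Mahler measure is $\log M(P)=\frac{1}{2\pi}\int_0^{2\pi}\log|P(e^{it})|\,dt$, and the areal Mahler measure is defined by $\log\|P\|_0=\frac{1}{\pi}\iint_{D}\log|P(z)|\,dA$, where $D$ is the open unit disk in $\mathbb{C}$ and $dA$ is area measure. $Z(P)$ denotes the number of roots of $P$ (counted with multiplicity) lying in the open unit disk. *)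

(* Defs.v *)
From mathcomp Require Import all_boot all_order all_algebra.
From mathcomp Require Import complex.
From mathcomp Require Import all_classical all_reals all_analysis.
Import Order.TTheory GRing.Theory Num.Theory.
Import numFieldNormedType.Exports.

Set Implicit Arguments.
Unset Strict Implicit.
Unset Printing Implicit Defensive.

Local Open Scope classical_set_scope.
Local Open Scope ring_scope.
Local Open Scope complex_scope.

(* The norm `|z| of z : R[i] is itself an element of R[i]; cabs is the same
   modulus, as an element of R. *)
Definition cabs (R : realType) (z : R[i]) : R := ComplexField.Normc.normc z.

(* In both integrals below the integrand takes the value ln 0 = 0, instead of
   -oo, at the roots of P; for P != 0 this only affects a null set. *)
Definition log_mahler (R : realType) (P : {poly R[i]}) : R :=
  (2 * pi)^-1 *
  \int[lebesgue_measure]_(t in `[0, 2 * pi]) ln (cabs P.[cos t +i* sin t]).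

(* The open unit disk, C being identified with R * R, so that the area measure
   is the product Lebesgue measure. *)
Definition unit_disk (R : realType) : set (R * R) :=
  [set xy | cabs (xy.1 +i* xy.2) < 1].
Arguments unit_disk : clear implicits.

Definition log_areal_mahler (R : realType) (P : {poly R[i]}) : R :=
  pi^-1 *
  \int[(lebesgue_measure \x lebesgue_measure)%E]_(xy in unit_disk R)
    ln (cabs P.[xy.1 +i* xy.2]).

Definition mahler (R : realType) (P : {poly R[i]}) : R := expR (log_mahler P).

Definition areal_mahler (R : realType) (P : {poly R[i]}) : R :=
  expR (log_areal_mahler P).

(* For P != 0, sval (closed_field_poly_normal P) lists the roots of P with
   multiplicity. *)
Definition nroots_disk (R : realType) (P : {poly R[i]}) : nat :=
  count (fun z => cabs z < 1) (sval (closed_field_poly_normal P)).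

Definition areal_coef (R : realType) (k : nat) : R :=
  \sum_(1 <= l < k.+2) (l%:R * (k.+2 - l)%:R)^-1 - k.+2%:R^-1.

(* Main.v *)
Require Import Defs.
From mathcomp Require Import all_boot all_order all_algebra.
From mathcomp Require Import complex.
From mathcomp Require Import all_classical all_reals all_analysis.
From mathcomp Require Import measurable_realfun ring lra.
Import Order.TTheory GRing.Theory Num.Theory.
Import numFieldNormedType.Exports.

Set Implicit Arguments.
Unset Strict Implicit.
Unset Printing Implicit Defensive.

Local Open Scope classical_set_scope.
Local Open Scope ring_scope.
Local Open Scope complex_scope.

(** Let [a] run over the roots of [P] in the unit disk, and put
    [u = - ln |a|] and [f u = u - (1 - expR (- 2u)) / 2]. As [|P(0)| = 1],
    Jensen's formula gives [ln (mahler P) = sum u] and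
    [ln (areal_mahler P) = sum (f u) =: L]. By Cauchy-Schwarz the left-hand
    side of the theorem is at most [sum (u ^ 2)]. The right-hand side is
    [L * h L] with [h] nondecreasing, hence at least [sum (f u * h L)], and it
    suffices that [u ^ 2 <= f u * h (f u)] for each root. Put [f u = y ^ 2] and
    [v = - ln (1 - y)]; squaring the Mercator series of [v] gives
    [f u * h (f u) = v ^ 2 - (f v - f u)]. Now
    [f v >= (1 - expR (- v)) ^ 2 = f u] forces [u <= v], and [t ^ 2 - f t] is
    nondecreasing in [t].

    The mean [K b] of [ln |1 - b z|] over the unit circle vanishes for [|b| < 1]
    because [|1 - b z| |1 + b z| = |1 - b^2 z^2|] gives [K (b^2) = 2 K b], while
    [K] is bounded on smaller disks; [|b| = 1] follows by monotone convergence.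
    The area integral of [ln |z - a|] is reduced to circle means by averaging
    over rotations, under which plane Lebesgue measure is invariant since
    rotations are products of shears; as the disk of squared radius [r] has
    area [pi * r], the resulting integral of a function of [|z|^2] reduces to
    one dimension. *)

(** * Functions with a given derivative *)

Section IsDerive.
Context {R : realType}.
Implicit Types (f df F : R -> R) (a b d x : R).
Local Notation mu := (@lebesgue_measure R).

Lemma is_derive_continuous f d x : is_derive x 1 f d -> {for x, continuous f}.
Proof. by case=> fx _; apply/differentiable_continuous/derivable1_diffP. Qed.

Lemma is_derive_within_continuous f df a b :
  (forall x, a <= x <= b -> is_derive x 1 f (df x)) ->
  {within `[a, b], continuous f}.
Proof.
move=> fd; apply: continuous_in_subspaceT => x.
by rewrite inE/= in_itv/= => /fd/is_derive_continuous.
Qed.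

Lemma is_derive_mean_value f df a b : a < b ->
  (forall x, a <= x <= b -> is_derive x 1 f (df x)) ->
  exists2 c, a < c < b & f b - f a = df c * (b - a).
Proof.
move=> ab fd.
have [|c cab fE] := @MVT R f df a b ab _ (is_derive_within_continuous fd).
  by move=> x; rewrite in_itv/= => /andP[ax xb]; apply: fd; rewrite !ltW.
by exists c => //; move: cab; rewrite in_itv.
Qed.

Lemma is_derive_ge0_le f df a b : a <= b ->
  (forall x, a <= x <= b -> is_derive x 1 f (df x)) ->
  (forall x, a <= x <= b -> 0 <= df x) -> f a <= f b.
Proof.
rewrite le_eqVlt => /predU1P[->//|ab] fd df0.
have [c /andP[ac cb] fE] := is_derive_mean_value ab fd.
rewrite -subr_ge0 fE mulr_ge0 ?subr_ge0 ?(ltW ab)//.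
by apply: df0; rewrite !ltW.
Qed.

Lemma integral_is_derive F f a b : a <= b ->
  (forall x, a <= x <= b -> is_derive x 1 F (f x)) ->
  {within `[a, b], continuous f} ->
  (\int[mu]_(x in `[a, b]) (f x)%:E)%E = (F b - F a)%:E.
Proof.
rewrite le_eqVlt => /predU1P[->|ab] dF cf.
  by rewrite set_itv1 integral_set1 subrr.
have dFoo x : x \in `]a, b[ -> is_derive x 1 F (f x).
  by rewrite in_itv/= => /andP[ax xb]; apply: dF; rewrite !ltW.
have Fc x : a <= x <= b -> {for x, continuous F}.
  by move=> /dF; exact: is_derive_continuous.
rewrite (continuous_FTC2 ab cf (F := F))//.
- split; first by move=> x /dFoo[].
    by apply/cvg_at_right_filter/Fc; rewrite lexx ltW.
  by apply/cvg_at_left_filter/Fc; rewrite lexx ltW.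
- by move=> x /dFoo[_ FE]; rewrite derive1E.
Qed.

Lemma Rintegral_is_derive F f a b : a <= b ->
  (forall x, a <= x <= b -> is_derive x 1 F (f x)) ->
  {within `[a, b], continuous f} ->
  \int[mu]_(x in `[a, b]) f x = F b - F a.
Proof.
by move=> ab dF cf; rewrite /Rintegral (integral_is_derive ab dF cf).
Qed.

Lemma continuous_itv_integrable f a b : {within `[a, b], continuous f} ->
  mu.-integrable `[a, b] (EFin \o f).
Proof. exact/continuous_compact_integrable/segment_compact. Qed.

Lemma continuous_antiderivative f a : continuous f ->
  exists F : R -> R, forall x, a <= x -> is_derive x 1 F (f x).
Proof.
move=> cf; exists (fun x => \int[mu]_(t in `[a - 1, x]) f t) => x ax.
have [] := @continuous_FTC1 R f (BLeft (a - 1)) x (x + 1).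
- by rewrite ltrDl.
- exact/continuous_itv_integrable/continuous_subspaceT.
- by rewrite lte_fin (lt_le_trans _ ax)// gtrBl.
- exact: cf.
by move=> dF FE; rewrite -FE derive1E; exact: derivableP.
Qed.

End IsDerive.

(** * The one-variable inequality *)

Section ArealPart.
Context {R : realType}.
Implicit Types u v y : R.

(* The contribution to [log_areal_mahler] of a root of modulus [expR (- u)] in
   the unit disk. *)
Definition areal_part u : R := u - (1 - expR (- (2 * u))) / 2.

Lemma expRN2 u : expR (- (2 * u)) = expR (- u) ^+ 2.
Proof. by rewrite -mulrN expRM_natl. Qed.

Lemma is_derive_areal_part u :
  is_derive u 1 areal_part (1 - expR (- (2 * u))).
Proof.
rewrite /areal_part; apply: is_derive_eq.
by rewrite /GRing.scale/=; field.
Qed.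

Lemma areal_part_ge u : 0 <= u -> (1 - expR (- u)) ^+ 2 <= areal_part u.
Proof.
move=> u0; pose g (t : R) : R := areal_part t - (1 - expR (- t)) ^+ 2.
have dg (t : R) : is_derive t 1 g ((1 - expR (- t)) ^+ 2).
  have ? := is_derive_areal_part t.
  by rewrite /g; apply: is_derive_eq; rewrite expRN2 /GRing.scale/=; ring.
have : g 0 <= g u.
  by apply: (is_derive_ge0_le u0 (fun t _ => dg t)) => t _; exact: sqr_ge0.
by rewrite /g /areal_part mulr0 oppr0 expR0 !subrr mul0r expr0n !subr0 subr_ge0.
Qed.

Lemma areal_part_ge0 u : 0 <= u -> 0 <= areal_part u.
Proof. by move=> u0; apply: le_trans (areal_part_ge u0); exact: sqr_ge0. Qed.

Lemma areal_part_lt u v : 0 <= u -> u < v -> areal_part u < areal_part v.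
Proof.
move=> u0 uv.
have [c /andP[uc _] E] :=
  is_derive_mean_value uv (fun x _ => is_derive_areal_part x).
rewrite -subr_gt0 E mulr_gt0 ?subr_gt0// expR_lt1 oppr_lt0 mulr_gt0//.
exact: le_lt_trans uc.
Qed.

Lemma sqr_sub_areal_part_le u v : u <= v ->
  u ^+ 2 - areal_part u <= v ^+ 2 - areal_part v.
Proof.
move=> uv; apply: (@is_derive_ge0_le _ (fun t => t ^+ 2 - areal_part t)
  (fun t => 2 * t - (1 - expR (- (2 * t)))) _ _ uv) => t _.
- have ? := is_derive_areal_part t.
  by apply: is_derive_eq; rewrite /GRing.scale/=; ring.
- have := expR_ge1Dx (- (2 * t)); lra.
Qed.

(* With [v = - ln (1 - y)] the right-hand side is
   [v ^+ 2 - (areal_part v - y ^+ 2)]. *)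
Lemma sqr_le_areal_part u y : 0 <= u -> 0 <= y < 1 -> y ^+ 2 = areal_part u ->
  u ^+ 2 <= ln (1 - y) ^+ 2 + ln (1 - y) + y + y ^+ 2 / 2.
Proof.
move=> u0 /andP[y0 y1] yE; set v := - ln (1 - y).
have v0 : 0 <= v by rewrite oppr_ge0 ln_le0// lerBlDr lerDl.
have ev : expR (- v) = 1 - y by rewrite opprK lnK// posrE subr_gt0.
have uv : u <= v.
  rewrite leNgt; apply/negP => /(areal_part_lt v0).
  by rewrite -yE; have := areal_part_ge v0; rewrite ev; nra.
have := sqr_sub_areal_part_le uv.
by rewrite -yE /areal_part expRN2 ev /v; nra.
Qed.

End ArealPart.

(** * The power series *)

Section CauchyProduct.
Context {R : realType}.
Implicit Types (u v : R^nat) (a b : R) (n : nat).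

Lemma series_ge0 u n : (forall i, 0 <= u i) -> 0 <= series u n.
Proof. by move=> u0; apply: sumr_ge0 => i _. Qed.

Lemma nondecreasing_series_ge0 u : (forall i, 0 <= u i) ->
  nondecreasing_seq (series u).
Proof.
by move=> u0; apply: (nondecreasing_series (P := xpredT) (m := 0)) => i _ _.
Qed.

Definition cauchy_product u v : R^nat :=
  fun n => \sum_(i < n.+1) u i * v (n - i)%N.

Lemma cauchy_product_ge0 u v n : (forall i, 0 <= u i) -> (forall i, 0 <= v i) ->
  0 <= cauchy_product u v n.
Proof. by move=> u0 v0; apply: sumr_ge0 => i _; rewrite mulr_ge0. Qed.

Lemma series_cauchy_product u v n : series (cauchy_product u v) n =
  \sum_(0 <= i < n) u i * series v (n - i)%N.
Proof.
elim: n => [|n IH]; first by rewrite seriesEnat/= !big_geq.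
rewrite seriesSr IH big_nat_recr//= subSnn seriesEnat/= big_nat1.
rewrite /cauchy_product big_ord_recr/= subnn addrA; congr (_ + _).
rewrite [X in _ + X](_ : _ = \sum_(0 <= i < n) u i * v (n - i)%N); last first.
  by rewrite big_mkord.
rewrite -big_split/=; apply: eq_big_nat => i /andP[_ ilen].
by rewrite -mulrDr subSn ?(ltnW ilen)// big_nat_recr.
Qed.

Lemma series_cauchy_product_le u v n :
  (forall i, 0 <= u i) -> (forall i, 0 <= v i) ->
  series (cauchy_product u v) n <= series u n * series v n.
Proof.
move=> u0 v0; rewrite series_cauchy_product [series u n]/series/= mulr_suml.
apply: ler_sum => i _; rewrite ler_wpM2l//.
by apply: nondecreasing_series_ge0; rewrite ?leq_subr.
Qed.

Lemma series_cauchy_product_ge u v n :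
  (forall i, 0 <= u i) -> (forall i, 0 <= v i) ->
  series u n * series v n <= series (cauchy_product u v) (n + n).
Proof.
move=> u0 v0; rewrite series_cauchy_product [series u n]/series/= mulr_suml.
rewrite (@big_cat_nat _ _ _ n 0 (n + n))//= ?leq_addr// ler_wpDr//.
  by apply: sumr_ge0 => i _; rewrite mulr_ge0 ?series_ge0.
rewrite !big_nat; apply: ler_sum => i /andP[_ ilen]; rewrite ler_wpM2l//.
by apply: nondecreasing_series_ge0; rewrite -?addnBA ?leq_addr// ltnW.
Qed.

Lemma cvg_series_cauchy_product u v a b :
  (forall i, 0 <= u i) -> (forall i, 0 <= v i) ->
  series u @ \oo --> a -> series v @ \oo --> b ->
  series (cauchy_product u v) @ \oo --> a * b.
Proof.
move=> u0 v0 ua vb.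
have uvab : series u n * series v n @[n --> \oo] --> a * b by exact: cvgM.
have nd_uv : nondecreasing_seq (series (cauchy_product u v)).
  by apply: nondecreasing_series_ge0 => i; exact: cauchy_product_ge0.
have nd_prod : nondecreasing_seq (fun n => series u n * series v n).
  by move=> m n mn; rewrite ler_pM ?series_ge0 ?nondecreasing_series_ge0.
have prod_le n : series u n * series v n <= a * b.
  by rewrite -(cvg_lim _ uvab)// nondecreasing_cvgn_le//; exact: cvgP uvab.
have uv_le n : series (cauchy_product u v) n <= a * b.
  exact: le_trans (series_cauchy_product_le _ u0 v0) (prod_le n).
have uv_cvg : cvgn (series (cauchy_product u v)).
  by apply: nondecreasing_is_cvgn => //; exists (a * b) => _ [n _ <-].
suff <- : limn (series (cauchy_product u v)) = a * b by [].
apply/eqP; rewrite eq_le; apply/andP; split.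
  by apply: limr_le => //; near=> n.
rewrite -(cvg_lim _ uvab)//; apply: limr_le; first exact: cvgP uvab.
near=> n; apply: le_trans (series_cauchy_product_ge _ u0 v0) _.
exact: nondecreasing_cvgn_le.
Unshelve. all: by end_near. Qed.

End CauchyProduct.

Section Mercator.
Context {R : realType}.
Implicit Types (y : R) (n : nat).

Definition mercator_coef y : R^nat := fun i => y ^+ i.+1 / i.+1%:R.

Lemma mercator_coef_ge0 y i : 0 <= y -> 0 <= mercator_coef y i.
Proof. by move=> y0; rewrite divr_ge0 ?exprn_ge0. Qed.

Lemma is_derive_mercator_coef y i :
  is_derive y 1 (mercator_coef ^~ i) (y ^+ i).
Proof.
rewrite (_ : (fun t => _) = i.+1%:R^-1 *: (@idfun R ^+ i.+1)); last first.
  by apply/funext => t; rewrite /mercator_coef mulrC [RHS]/= fctE.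
by apply: is_derive_eq; rewrite /GRing.scale/= mulr1 mulKf// pnatr_eq0.
Qed.

Lemma is_derive_series_mercator n y :
  is_derive y 1 (fun t => series (mercator_coef t) n)
    (series (geometric 1 y) n).
Proof.
elim: n => [|n IH].
  rewrite [series _]/series/= big_geq//.
  rewrite (_ : (fun t => _) = cst 0); first exact: is_derive_cst.
  by apply/funext => t; rewrite seriesEnat/= big_geq.
rewrite (_ : (fun t => _) =
    (fun t => series (mercator_coef t) n) \+ (mercator_coef ^~ n)); last first.
  by apply/funext => t; rewrite seriesSr.
have ? := is_derive_mercator_coef y n.
by rewrite seriesSr/= mul1r; exact: is_deriveD.
Qed.

Lemma is_derive_ln_onem y : y < 1 ->
  is_derive y 1 (fun t => ln (1 - t)) (- (1 - y)^-1).
Proof.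
move=> y1; have y10 : 0 < 1 - y by rewrite subr_gt0.
have d1 : is_derive y 1 (fun t : R => 1 - t) (- 1).
  apply: is_derive_eq (is_deriveB (is_derive_cst (1 : R) y 1) _) _.
  by rewrite sub0r.
by apply: is_derive_eq (@is_derive1_comp R _ (fun t => 1 - t) y _ _
  (is_derive1_ln y10) d1) _; rewrite mulrN1.
Qed.

Lemma is_derive_mercator_remainder n y : y < 1 ->
  is_derive y 1 (fun t => - ln (1 - t) - series (mercator_coef t) n)
    (y ^+ n / (1 - y)).
Proof.
move=> y1; have ? := is_derive_ln_onem y1.
have ? := is_derive_series_mercator n y.
apply: is_derive_eq; rewrite geometric_seriesE ?lt_eqF//= opprK mul1r.
by field; rewrite subr_eq0 gt_eqF.
Qed.

Lemma mercator_remainder_bounds n y : 0 <= y < 1 ->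
  0 <= - ln (1 - y) - series (mercator_coef y) n <= y ^+ n / (1 - y).
Proof.
have remainder0 : - ln (1 - 0) - series (mercator_coef 0) n = 0 :> R.
  rewrite subr0 ln1 oppr0 sub0r /series/= big1 ?oppr0// => i _.
  by rewrite /mercator_coef expr0n mul0r.
move=> /andP[]; rewrite le_eqVlt => /predU1P[<- _|y0 y1].
  by rewrite remainder0 lexx subr0 divr1 exprn_ge0.
have [c /andP[c0 cy]] := is_derive_mean_value y0
  (df := fun t => t ^+ n / (1 - t))
  (fun t ty => is_derive_mercator_remainder n (le_lt_trans (andP ty).2 y1)).
rewrite remainder0 !subr0 => ->; have c1 : c < 1 by exact: lt_trans y1.
have d0 : 0 <= c ^+ n / (1 - c) by rewrite divr_ge0 ?exprn_ge0 ?subr_ge0 ?ltW.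
rewrite mulr_ge0 ?(ltW y0)//=; apply: (@le_trans _ _ (c ^+ n / (1 - c))).
  by rewrite ler_piMr// ltW.
rewrite ler_pM ?exprn_ge0 ?invr_ge0 ?subr_ge0 ?(ltW c0) ?(ltW c1)//.
  by rewrite lerXn2r ?nnegrE ?ltW.
by rewrite lef_pV2 ?posrE ?subr_gt0// lerB// ltW.
Qed.

Lemma cvg_series_mercator y : 0 <= y < 1 ->
  series (mercator_coef y) @ \oo --> - ln (1 - y).
Proof.
move=> y01; have /andP[y0 y1] := y01.
apply: (@squeeze_cvgr _ _ _ _ (fun n => - ln (1 - y) - y ^+ n / (1 - y))
  (cst (- ln (1 - y)))); last exact: cvg_cst.
- near=> n; have /andP[] := mercator_remainder_bounds n y01.
  by rewrite subr_ge0 lerBlDr -lerBlDl => -> ->.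
- rewrite -[X in _ --> X]subr0 -(mul0r (1 - y)^-1).
  apply: cvgB; first exact: cvg_cst.
  by apply: cvgMr_tmp; apply: cvg_expr; rewrite ger0_norm.
Unshelve. all: by end_near. Qed.

End Mercator.

Section ArealSum.
Context {R : realType}.
Implicit Types (y z : R) (n k : nat).

Definition areal_sum y : R^nat :=
  fun n => \sum_(1 <= k < n) areal_coef R k * y ^+ k.

Lemma areal_coef_ge0 k : 0 <= areal_coef R k.
Proof.
rewrite /areal_coef subr_ge0 big_ltn// subn1/= mul1r.
rewrite ler_wpDr ?lef_pV2 ?posrE ?ler_nat//.
by apply: sumr_ge0 => i _; rewrite invr_ge0.
Qed.

Lemma areal_coefX k y : areal_coef R k * y ^+ k.+2 =
  cauchy_product (mercator_coef y) (mercator_coef y) k - mercator_coef y k.+1.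
Proof.
rewrite /areal_coef mulrBl; congr (_ - _); last by rewrite mulrC.
rewrite mulr_suml big_add1/= big_mkord; apply: eq_bigr => i _.
have ik : (i <= k)%N by rewrite -ltnS.
rewrite /mercator_coef subSS subSn//.
rewrite (_ : y ^+ k.+2 = y ^+ i.+1 * y ^+ (k - i).+1).
  by rewrite invfM; ring.
by rewrite -exprD addSn addnS subnKC.
Qed.

Lemma areal_sumS y n : y ^+ 2 * (1 + areal_sum y n.+1) =
  series (cauchy_product (mercator_coef y) (mercator_coef y)) n.+1 -
  series (mercator_coef y) n.+2 + y + y ^+ 2 / 2.
Proof.
elim: n => [|n IH].
  rewrite /areal_sum big_geq// !seriesSr ![series _ 0]/series/= !big_geq//.
  by rewrite /cauchy_product big_ord1 subnn /mercator_coef/=; field.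
rewrite /areal_sum/= big_nat_recr//= -/(areal_sum y n.+1) addrA mulrDr IH.
rewrite mulrCA -exprD add2n areal_coefX.
rewrite [series (cauchy_product _ _) n.+2]seriesSr.
rewrite [series (mercator_coef y) n.+3]seriesSr; ring.
Qed.

Lemma cvg_areal_sumM y : 0 <= y < 1 ->
  y ^+ 2 * (1 + areal_sum y n) @[n --> \oo] -->
  ln (1 - y) ^+ 2 + ln (1 - y) + y + y ^+ 2 / 2.
Proof.
move=> y01; have /andP[y0 _] := y01; have m_cvg := cvg_series_mercator y01.
rewrite -(cvg_shiftS (fun n => y ^+ 2 * (1 + areal_sum y n)))/=.
under eq_fun do rewrite areal_sumS.
apply: cvgD; last exact: cvg_cst.
apply: cvgD; last exact: cvg_cst.
have -> : ln (1 - y) ^+ 2 + ln (1 - y) =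
    - ln (1 - y) * - ln (1 - y) - - ln (1 - y) by ring.
apply: cvgB.
  rewrite (cvg_shiftS (series (cauchy_product (mercator_coef y) _))).
  by apply: cvg_series_cauchy_product => // i; exact: mercator_coef_ge0.
rewrite (cvg_shiftS (fun n => series (mercator_coef y) n.+1)).
by rewrite cvg_shiftS.
Qed.

Lemma is_cvg_areal_sum y : 0 <= y < 1 -> cvgn (areal_sum y).
Proof.
move=> y01; have [->|y0] := eqVneq y 0.
  rewrite (_ : areal_sum 0 = cst 0); first exact: is_cvg_cst.
  apply/funext => n; rewrite /areal_sum big_nat big1//= => i /andP[i1 _].
  by rewrite expr0n eqn0Ngt i1/= mulr0.
rewrite (_ : areal_sum y =
    (fun n => y ^- 2 * (y ^+ 2 * (1 + areal_sum y n)) - 1)); last first.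
  by apply/funext => n; rewrite mulKf ?expf_neq0// addrC addKr.
apply: cvgP; apply: cvgB; last exact: cvg_cst.
by apply: cvgMl_tmp; exact: cvg_areal_sumM.
Qed.

Lemma lim_areal_sumM y : 0 <= y < 1 -> y ^+ 2 * (1 + limn (areal_sum y)) =
  ln (1 - y) ^+ 2 + ln (1 - y) + y + y ^+ 2 / 2.
Proof.
move=> y01; rewrite -(cvg_lim _ (cvg_areal_sumM y01))//.
apply/esym/cvg_lim => //; apply: cvgMl_tmp.
by apply: cvgD; [exact: cvg_cst|exact: is_cvg_areal_sum].
Qed.

Lemma lim_areal_sum_le y z : 0 <= y -> y <= z -> z < 1 ->
  limn (areal_sum y) <= limn (areal_sum z).
Proof.
move=> y0 yz z1; apply: ler_lim.
- by apply: is_cvg_areal_sum; rewrite y0 (le_lt_trans yz).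
- by apply: is_cvg_areal_sum; rewrite z1 (le_trans y0).
near=> n; apply: ler_sum => i _; rewrite ler_wpM2l ?areal_coef_ge0//.
by rewrite lerXn2r ?nnegrE// (le_trans y0).
Unshelve. all: by end_near. Qed.

End ArealSum.

Section SumInequality.
Context {R : realType}.

Lemma sqr_sum_le (I : Type) (s : seq I) (u : I -> R) : (0 < size s)%N ->
  (\sum_(i <- s) u i) ^+ 2 / (size s)%:R <= \sum_(i <- s) u i ^+ 2.
Proof.
move=> s0; have n0 : (size s)%:R != 0 :> R by rewrite pnatr_eq0 -lt0n.
set S := \sum_(i <- s) u i; set m := S / (size s)%:R.
have : 0 <= \sum_(i <- s) (u i - m) ^+ 2.
  by apply: sumr_ge0 => i _; exact: sqr_ge0.
have sumE (r : seq I) : \sum_(i <- r) (u i - m) ^+ 2 =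
    \sum_(i <- r) u i ^+ 2 - 2 * m * \sum_(i <- r) u i + (size r)%:R * m ^+ 2.
  elim: r => [|i r IH]; first by rewrite !big_nil/=; ring.
  by rewrite !big_cons IH/= -natr1; ring.
rewrite sumE -/S => sum_ge0; rewrite -subr_ge0.
rewrite (_ : _ - S ^+ 2 / _ = \sum_(i <- s) u i ^+ 2 - 2 * m * S +
  (size s)%:R * m ^+ 2)//.
by rewrite /m; field.
Qed.

Lemma sqr_le_areal_sum (u L : R) : 0 <= u -> areal_part u <= L -> L < 1 ->
  u ^+ 2 <= areal_part u * (1 + limn (areal_sum (Num.sqrt L))).
Proof.
move=> u0 uL L1; pose y := Num.sqrt (areal_part u).
have yE : y ^+ 2 = areal_part u by rewrite sqr_sqrtr// areal_part_ge0.
have yL : y <= Num.sqrt L by rewrite ler_wsqrtr.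
have sL1 : Num.sqrt L < 1 by rewrite -sqrtr1 ltr_sqrt.
have y01 : 0 <= y < 1 by rewrite sqrtr_ge0 (le_lt_trans yL).
apply: le_trans (sqr_le_areal_part u0 y01 yE) _.
rewrite -lim_areal_sumM// yE ler_wpM2l ?areal_part_ge0// lerD2l.
by rewrite lim_areal_sum_le// sqrtr_ge0.
Qed.

Lemma sqr_sum_le_areal_sum (I : eqType) (s : seq I) (u : I -> R) :
  (0 < size s)%N -> (forall i, i \in s -> 0 <= u i) ->
  let L := \sum_(i <- s) areal_part (u i) in L < 1 ->
  (\sum_(i <- s) u i) ^+ 2 / (size s)%:R <=
  L * (1 + limn (areal_sum (Num.sqrt L))).
Proof.
move=> s0 u0 L L1; apply: le_trans (sqr_sum_le _ s0) _.
rewrite {1}/L mulr_suml big_seq [leRHS]big_seq.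
apply: ler_sum => i si; apply: sqr_le_areal_sum => //; first exact: u0.
rewrite /L (big_rem i)//= lerDl big_seq sumr_ge0// => j /mem_rem js.
exact/areal_part_ge0/u0.
Qed.

End SumInequality.

(** * Monotone convergence for integrable functions *)

Section RealIntegral.
Context d (T : measurableType d) {R : realType}.
Variable mu : {measure set T -> \bar R}.
Implicit Types (D : set T) (f g h : T -> R) (c v : R).

Lemma ge0_fin_integrable D f v : measurable D -> measurable_fun D f ->
  (forall x, D x -> 0 <= f x) ->
  (\int[mu]_(x in D) (f x)%:E = v%:E)%E -> mu.-integrable D (EFin \o f).
Proof.
move=> mD mf f0 fv; apply/integrableP; split; first exact/measurable_EFinP.
rewrite (eq_integral (fun x => (f x)%:E)) ?fv ?ltry// => x.
by rewrite inE => /f0 fx0; rewrite /= ger0_norm.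
Qed.

Variable D : set T.
Hypothesis mD : measurable D.

Lemma EFin_Rintegral f : mu.-integrable D (EFin \o f) ->
  (\int[mu]_(x in D) (f x)%:E)%E = (\int[mu]_(x in D) f x)%:E.
Proof. by move=> fi; rewrite fineK// integrable_fin_num. Qed.

Lemma integrable_subK f g : mu.-integrable D (EFin \o g) ->
  mu.-integrable D (EFin \o (g \- f)) -> mu.-integrable D (EFin \o f).
Proof.
move=> ig igf; have := integrableB mD ig igf.
by apply: eq_integrable => // x _ /=; rewrite -EFinB subKr.
Qed.

Lemma Rintegral_subK f g : mu.-integrable D (EFin \o g) ->
  mu.-integrable D (EFin \o (g \- f)) ->
  \int[mu]_(x in D) f x =
  \int[mu]_(x in D) g x - \int[mu]_(x in D) (g x - f x).
Proof.
move=> ig igf; rewrite -RintegralB//.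
by apply: eq_Rintegral => x _; rewrite subKr.
Qed.

Lemma ae_eq_integrable (f g : T -> \bar R) : measurable_fun D g ->
  ae_eq mu D f g -> mu.-integrable D f -> mu.-integrable D g.
Proof.
move=> mg fg /integrableP[mf foo]; apply/integrableP; split => //.
rewrite (@ae_eq_integral _ _ _ mu D (abse \o f) (abse \o g))//.
- exact: measurableT_comp.
- exact: measurableT_comp.
- exact/ae_eq_sym/(ae_eq_comp _ fg).
Qed.

Lemma nonincreasing_cvg_Rintegral (g : nat -> T -> R) h v :
  (forall n, mu.-integrable D (EFin \o g n)) ->
  (forall x, D x -> nonincreasing_seq (g ^~ x)) ->
  measurable_fun D h ->
  {ae mu, forall x, D x -> g n x @[n --> \oo] --> h x} ->
  \int[mu]_(x in D) g n x @[n --> \oo] --> v ->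
  mu.-integrable D (EFin \o h) /\ \int[mu]_(x in D) h x = v.
Proof.
move=> ig g_ni mh [N [mN N0 gN]] gv.
have gh x : (D `\` N) x -> g n x @[n --> \oo] --> h x.
  by case=> Dx Nx; apply: contrapT => ngh; apply: Nx; apply: gN => /(_ Dx).
have igB n : mu.-integrable D (EFin \o (g 0%N \- g n)).
  exact: (integrableB mD (ig 0%N) (ig n)).
have gBE n : (\int[mu]_(x in D `\` N) (g 0%N x - g n x)%:E =
    (\int[mu]_(x in D) g 0%N x - \int[mu]_(x in D) g n x)%:E)%E.
  rewrite -(negligible_integral mN mD (igB n) N0) (EFin_Rintegral (igB n)).
  by rewrite RintegralB.
have mDN : measurable (D `\` N) by exact: measurableD.
have lim_gB : (\int[mu]_(x in D `\` N) (g 0%N x - g n x)%:E)%E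
    @[n --> \oo] --> (\int[mu]_(x in D `\` N) (g 0%N x - h x)%:E)%E.
  rewrite (eq_integral (fun x => limn (fun n => (g 0%N x - g n x)%:E))).
    apply: cvg_monotone_convergence => //.
    - move=> n; apply: (measurable_int mu).
      by apply: (integrableS mD mDN _ (igB n)); exact: subDsetl.
    - by move=> n x [Dx _]; rewrite lee_fin subr_ge0 g_ni.
    - by move=> x [Dx _] m n mn; rewrite lee_fin lerB// g_ni.
  move=> x; rewrite inE => /gh ghx; apply/esym/cvg_lim => //.
  by apply: cvg_EFin; [near=> n|apply: cvgB => //; exact: cvg_cst].
have hE : (\int[mu]_(x in D `\` N) (g 0%N x - h x)%:E =
    (\int[mu]_(x in D) g 0%N x - v)%:E)%E.
  apply: cvg_unique lim_gB _ => //=; under eq_fun do rewrite gBE.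
  by apply: cvg_EFin; [near=> n|apply: cvgB => //; exact: cvg_cst].
have mg0h : measurable_fun D (g 0%N \- h).
  apply: measurable_funB => //.
  exact/measurable_EFinP/(measurable_int _ (ig _)).
have igh : mu.-integrable D (EFin \o (g 0%N \- h)).
  apply/(negligible_integrable mN mD _ N0); first exact/measurable_EFinP.
  apply: (ge0_fin_integrable mDN _ _ hE); first exact: measurable_funS mg0h.
  move=> x DNx; have [Dx _] := DNx; rewrite subr_ge0 -(cvg_lim _ (gh x DNx))//.
  by apply: (nonincreasing_cvgn_ge (g_ni x Dx)); exact: cvgP (gh x DNx).
split; first exact: integrable_subK igh.
rewrite (Rintegral_subK (ig 0%N) igh) [X in _ - X](_ : _ =
  \int[mu]_(x in D) g 0%N x - v) ?subKr//.
by apply: EFin_inj; rewrite -EFin_Rintegral// -hE -negligible_integral.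
Unshelve. all: by end_near. Qed.

Hypothesis Doo : (mu D < +oo)%E.

Lemma lty_integrable_cst c : mu.-integrable D (EFin \o cst c).
Proof.
apply/integrableP; split; first exact/measurable_EFinP/measurable_cst.
rewrite (eq_integral (cst `|c|%:E))// integral_cst//.
exact: lte_mul_pinfty.
Qed.

Lemma integral_cstB f c : mu.-integrable D (EFin \o f) ->
  (\int[mu]_(x in D) (c - f x)%:E =
   (c * fine (mu D) - \int[mu]_(x in D) f x)%:E)%E.
Proof.
move=> fi; have ci := lty_integrable_cst c.
rewrite EFin_Rintegral ?RintegralB ?Rintegral_cst//.
exact: (integrableB mD ci fi).
Qed.

Lemma integrable_ub f c v : measurable_fun D f -> (forall x, D x -> f x <= c) ->
  (\int[mu]_(x in D) (c - f x)%:E = v%:E)%E ->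
  mu.-integrable D (EFin \o f) /\
  \int[mu]_(x in D) f x = c * fine (mu D) - v.
Proof.
move=> mf fc fv; have ci := lty_integrable_cst c.
have icf : mu.-integrable D (EFin \o (cst c \- f)).
  apply: (ge0_fin_integrable mD _ _ fv); first exact: measurable_funB.
  by move=> x Dx; rewrite subr_ge0 fc.
split; first exact: integrable_subK icf.
by rewrite (Rintegral_subK ci icf) Rintegral_cst// /Rintegral fv.
Qed.

End RealIntegral.

(** * Integrals of logarithms of products *)

Section LnIntegrable.
Context d (T : measurableType d) {R : realType}.
Variables (mu : {measure set T -> \bar R}) (D : set T).
Hypotheses (mD : measurable D) (Doo : (mu D < +oo)%E).
Implicit Types (g h : T -> R).

Definition ln_integrable g :=
  [/\ measurable_fun D g, {ae mu, forall x, D x -> 0 < g x} &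
      mu.-integrable D (fun x => (ln (g x))%:E)].

Lemma ae_eq_lnM g h : ln_integrable g -> ln_integrable h ->
  ae_eq mu D (fun x => (ln (g x) + ln (h x))%:E)
    (fun x => (ln (g x * h x))%:E).
Proof.
move=> [_ g0 _] [_ h0 _]; apply: filterS2 g0 h0 => x gx0 hx0 Dx.
by rewrite lnM ?posrE ?gx0 ?hx0.
Qed.

Lemma measurable_ln_comp g : measurable_fun D g ->
  measurable_fun D (fun x => (ln (g x))%:E).
Proof.
by move=> mg; apply/measurable_EFinP/measurableT_comp.
Qed.

Lemma ln_integrableM g h : ln_integrable g -> ln_integrable h ->
  ln_integrable (fun x => g x * h x).
Proof.
move=> lg lh; have [mg g0 ig] := lg; have [mh h0 ih] := lh.
have mgh : measurable_fun D (fun x => g x * h x) by exact: measurable_funM.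
split => //.
  by apply: filterS2 g0 h0 => x gx0 hx0 Dx; rewrite mulr_gt0 ?gx0 ?hx0.
apply: (ae_eq_integrable mD (measurable_ln_comp mgh) (ae_eq_lnM lg lh)).
exact: (integrableD mD ig ih).
Qed.

Lemma Rintegral_lnM g h : ln_integrable g -> ln_integrable h ->
  \int[mu]_(x in D) ln (g x * h x) =
  \int[mu]_(x in D) ln (g x) + \int[mu]_(x in D) ln (h x).
Proof.
move=> lg lh; have [mg _ ig] := lg; have [mh _ ih] := lh.
rewrite -RintegralD// /Rintegral; congr fine; apply/esym/ae_eq_integral => //.
- exact: measurable_int (integrableD mD ig ih).
- by apply: measurable_ln_comp; exact: measurable_funM.
- exact: ae_eq_lnM.
Qed.

Lemma ln_integrable_cst (c : R) : 0 < c -> ln_integrable (fun=> c).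
Proof.
move=> c0; split; [exact: measurable_cst|exact: aeW|].
exact: lty_integrable_cst.
Qed.

Lemma ln_integrable_prod (I : eqType) (s : seq I) (g : I -> T -> R) :
  (forall i, i \in s -> ln_integrable (g i)) ->
  ln_integrable (fun x => \prod_(i <- s) g i x).
Proof.
elim: s => [|i s IH] lg.
  by under eq_fun do rewrite big_nil; exact: ln_integrable_cst.
under eq_fun do rewrite big_cons.
apply: ln_integrableM; first by apply: lg; rewrite mem_head.
by apply: IH => j js; apply: lg; rewrite in_cons js orbT.
Qed.

Lemma Rintegral_ln_prod (I : eqType) (s : seq I) (g : I -> T -> R) :
  (forall i, i \in s -> ln_integrable (g i)) ->
  \int[mu]_(x in D) ln (\prod_(i <- s) g i x) =
  \sum_(i <- s) \int[mu]_(x in D) ln (g i x).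
Proof.
elim: s => [|i s IH] lg.
  under eq_Rintegral do rewrite big_nil ln1.
  by rewrite Rintegral_cst// mul0r big_nil.
have lgs j : j \in s -> ln_integrable (g j).
  by move=> js; apply: lg; rewrite in_cons js orbT.
under eq_Rintegral do rewrite big_cons.
rewrite Rintegral_lnM ?IH ?big_cons//; last exact: ln_integrable_prod.
by apply: lg; rewrite mem_head.
Qed.

End LnIntegrable.

(** * Logarithmic means over the circle *)

Section Modulus.
Context {R : realType}.
Implicit Types (x y t : R) (z w : R[i]).

Lemma cabsE x y : cabs (x +i* y) = Num.sqrt (x ^+ 2 + y ^+ 2).
Proof. by []. Qed.

Lemma cabs_sqr z : cabs z ^+ 2 = complex.Re z ^+ 2 + complex.Im z ^+ 2.
Proof. by case: z => x y; rewrite cabsE sqr_sqrtr// addr_ge0 ?sqr_ge0. Qed.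

Lemma cabs_ge0 z : 0 <= cabs z.
Proof. by case: z => x y; rewrite cabsE sqrtr_ge0. Qed.

Lemma cabs0 : cabs (0 : R[i]) = 0.
Proof. exact: ComplexField.Normc.normc0. Qed.

Lemma cabs1 : cabs (1 : R[i]) = 1.
Proof. exact: ComplexField.Normc.normc1. Qed.

Lemma cabs_eq0 z : (cabs z == 0) = (z == 0).
Proof.
apply/eqP/eqP => [|->]; last exact: cabs0.
exact: ComplexField.Normc.eq0_normc.
Qed.

Lemma cabs_gt0 z : (0 < cabs z) = (z != 0).
Proof. by rewrite lt_neqAle cabs_ge0 andbT eq_sym cabs_eq0. Qed.

Lemma cabsM : {morph @cabs R : z w / z * w}.
Proof. exact: ComplexField.Normc.normcM. Qed.

Lemma cabsV : {morph @cabs R : z / z^-1}.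
Proof. exact: ComplexField.Normc.normcV. Qed.

Lemma cabsN z : cabs (- z) = cabs z.
Proof. by case: z => x y; rewrite [LHS]cabsE !sqrrN. Qed.

Lemma cabs_conjc z : cabs z^*%C = cabs z.
Proof. by case: z => x y; rewrite [LHS]cabsE sqrrN. Qed.

Lemma ler_cabsD z w : cabs (z + w) <= cabs z + cabs w.
Proof. exact: (@le_normcD R). Qed.

Lemma ler_cabsB z w : cabs (z - w) <= cabs z + cabs w.
Proof. by rewrite -(cabsN w) ler_cabsD. Qed.

Lemma lerB_cabs z w : cabs z - cabs w <= cabs (z - w).
Proof. by rewrite lerBlDr -{1}(subrK w z) ler_cabsD. Qed.

Lemma cabsX n : {morph @cabs R : z / z ^+ n}.
Proof.
by move=> z; elim: n => [|n IH]; rewrite ?expr0 ?cabs1// !exprS cabsM IH.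
Qed.

Lemma cabs_prod (I : Type) (s : seq I) (F : I -> R[i]) :
  cabs (\prod_(i <- s) F i) = \prod_(i <- s) cabs (F i).
Proof. exact: (big_morph _ cabsM cabs1). Qed.

Definition expi t : R[i] := cos t +i* sin t.

Lemma cabs_expi t : cabs (expi t) = 1.
Proof. by rewrite cabsE cos2Dsin2 sqrtr1. Qed.

Lemma expi_neq0 t : expi t != 0.
Proof. by rewrite -cabs_eq0 cabs_expi oner_eq0. Qed.

Lemma expiV t : (expi t)^-1 = (expi t)^*%C.
Proof.
apply: (mulfI (expi_neq0 t)); rewrite divff ?expi_neq0//.
apply/eqP; rewrite eq_complex/= mulrN opprK -!expr2 cos2Dsin2 eqxx/=.
by rewrite mulrN [sin t * _]mulrC addNr.
Qed.

Lemma expi_double t : expi (2 * t) = expi t ^+ 2.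
Proof.
by rewrite mulr_natl mulr2n /expi cosD sinD [sin t * _ + _]addrC.
Qed.

Lemma expiDpi t : expi (t + pi) = - expi t.
Proof. by rewrite /expi cosDpi sinDpi. Qed.

Lemma continuous_sqr (f : R -> R) : continuous f ->
  continuous (fun t => f t ^+ 2).
Proof.
move=> cf t; apply: (@continuous_comp _ _ _ f (fun x => x ^+ 2)).
  exact: cf.
exact: exprn_continuous.
Qed.

Lemma continuous_cabs (u v : R -> R) : continuous u -> continuous v ->
  continuous (fun t => cabs (u t +i* v t)).
Proof.
move=> cu cv t; apply: continuous_comp; last exact: sqrt_continuous.
by apply: cvgD; exact: continuous_sqr.
Qed.

Lemma continuous_cabs_expi z w : continuous (fun t => cabs (expi t * z + w)).
Proof.
have cc := @continuous_cos R; have cs := @continuous_sin R.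
case: z w => [x y] [a b].
apply: (@continuous_cabs (fun t => cos t * x - sin t * y + a)
  (fun t => cos t * y + sin t * x + b)) => t.
- apply: cvgD; last exact: cvg_cst.
  by apply: cvgB; apply: cvgMr_tmp; [exact: cc|exact: cs].
- apply: cvgD; last exact: cvg_cst.
  by apply: cvgD; apply: cvgMr_tmp; [exact: cc|exact: cs].
Qed.

End Modulus.

Section CircleMean.
Context {R : realType}.
Implicit Types (t : R) (a b z : R[i]).
Local Notation mu := (@lebesgue_measure R).
Local Notation period := (`[0, 2 * pi]%classic : set (measurableTypeR R)).

Lemma measurable_period : measurable period.
Proof. exact: measurable_itv. Qed.

Lemma lebesgue_measure_period : mu period = (2 * pi)%:E.
Proof.
by rewrite lebesgue_measure_itv/= lte_fin mulr_gt0 ?pi_gt0//= oppr0 addr0.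
Qed.

Lemma lebesgue_measure_period_lty : (mu period < +oo)%E.
Proof. by rewrite lebesgue_measure_period ltry. Qed.

Lemma Rintegral_period_cst (c : R) : \int[mu]_(t in period) c = 2 * pi * c.
Proof.
rewrite Rintegral_cst; last exact: measurable_period.
by rewrite [X in fine X]lebesgue_measure_period mulrC.
Qed.

Lemma Rintegral_doubling (f g : R -> R) (p : R) : 0 < p ->
  continuous f -> continuous g ->
  (forall t, f t + f (t + p) = g (2 * t)) ->
  \int[mu]_(t in `[0, 2 * p]) g t = 2 * \int[mu]_(t in `[0, 2 * p]) f t.
Proof.
move=> p0 cf cg fg; have p20 : 0 <= 2 * p by rewrite mulr_ge0 ?ltW.
have [F dF] := continuous_antiderivative 0 cf.
have [G dG] := continuous_antiderivative 0 cg.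
have FE := Rintegral_is_derive p20 (fun t h => dF t (andP h).1).
have GE := Rintegral_is_derive p20 (fun t h => dG t (andP h).1).
rewrite FE ?GE; [|exact: continuous_subspaceT..].
have dH t : 0 <= t <= p ->
    is_derive t 1 (fun t => F t + F (t + p) - G (2 * t) / 2) 0.
  move=> /andP[t0 _]; have ? := dF _ t0.
  have dFp : is_derive t 1 (fun t => F (t + p)) (f (t + p)).
    apply: is_derive_eq (@is_derive1_comp R F (fun t => t + p) t _ _
      (dF _ _) (is_deriveD (is_derive_id t 1) (is_derive_cst p t 1))) _.
      by rewrite addr_ge0// ltW.
    by rewrite addr0 mulr1.
  have dG2 : is_derive t 1 (fun t => G (2 * t)) (2 * g (2 * t)).
    apply: is_derive_eq (@is_derive1_comp R G (fun t => 2 * t) t _ _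
      (dG _ _) (is_deriveZ 2 (is_derive_id t 1))) _; first by rewrite mulr_ge0.
    by rewrite /GRing.scale/= mulr1 mulrC.
  by apply: is_derive_eq; rewrite /GRing.scale/= -fg; field.
have [c _] := is_derive_mean_value p0 dH.
rewrite mul0r add0r mulr0 (_ : p + p = 2 * p); [lra|ring].
Qed.

Lemma circle_factor_bounds b t :
  1 - cabs b <= cabs (1 - b * expi t) <= 1 + cabs b.
Proof.
have := lerB_cabs 1 (b * expi t); have := ler_cabsB 1 (b * expi t).
by rewrite cabsM cabs_expi mulr1 cabs1 => -> ->.
Qed.

Lemma circle_factor_gt0 b t : cabs b < 1 -> 0 < cabs (1 - b * expi t).
Proof.
move=> b1; have /andP[+ _] := circle_factor_bounds b t.
by apply: lt_le_trans; rewrite subr_gt0.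
Qed.

Lemma continuous_circle_factor b : continuous (fun t => cabs (1 - b * expi t)).
Proof.
rewrite (_ : (fun t => _) = fun t => cabs (expi t * - b + 1)).
  exact: continuous_cabs_expi.
by apply/funext => t; rewrite mulrN mulrC addrC.
Qed.

Lemma continuous_ln_circle_factor b : cabs b < 1 ->
  continuous (fun t => ln (cabs (1 - b * expi t))).
Proof.
move=> b1 t; apply: continuous_comp; first exact: continuous_circle_factor.
exact/continuous_ln/circle_factor_gt0.
Qed.

Lemma integrable_ln_circle_factor_lt1 b : cabs b < 1 ->
  mu.-integrable period (EFin \o (fun t => ln (cabs (1 - b * expi t)))).
Proof.
move=> b1; apply: continuous_itv_integrable; apply: continuous_subspaceT.
exact: continuous_ln_circle_factor.
Qed.

Lemma ln_circle_factor_bound b t : cabs b < 1 ->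
  `|ln (cabs (1 - b * expi t))| <= - ln (1 - cabs b).
Proof.
move=> b1; have /andP[lo hi] := circle_factor_bounds b t.
have b0 := cabs_ge0 b; have b10 : 0 < 1 - cabs b by rewrite subr_gt0.
have f0 := circle_factor_gt0 t b1.
rewrite ler_norml opprK ler_ln ?posrE// lo/= -lnV ?posrE//.
rewrite ler_ln ?posrE ?invr_gt0// (le_trans hi)//.
by rewrite -[leRHS]mul1r ler_pdivlMr//; nra.
Qed.

Definition circle_mean b : R :=
  \int[mu]_(t in period) ln (cabs (1 - b * expi t)).

Lemma circle_mean_sqr b : cabs b < 1 ->
  circle_mean (b ^+ 2) = 2 * circle_mean b.
Proof.
move=> b1; have b21 : cabs (b ^+ 2) < 1 by rewrite cabsX expr_lt1 ?cabs_ge0.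
apply: Rintegral_doubling; first exact: pi_gt0.
- exact: continuous_ln_circle_factor.
- exact: continuous_ln_circle_factor.
move=> t; rewrite -lnM ?posrE; last exact: circle_factor_gt0.
  by rewrite -cabsM expi_double expiDpi; congr (ln (cabs _)); ring.
exact: circle_factor_gt0.
Qed.

Lemma circle_mean_bound b : cabs b < 1 ->
  `|circle_mean b| <= 2 * pi * - ln (1 - cabs b).
Proof.
move=> b1; have fi := integrable_ln_circle_factor_lt1 b1.
apply: le_trans (le_normr_Rintegral _ fi) _; first exact: measurable_period.
rewrite -Rintegral_period_cst; apply: le_Rintegral.
- exact: measurable_period.
- exact: integrable_norm.
- exact: (lty_integrable_cst measurable_period lebesgue_measure_period_lty).
- by move=> t _; exact: ln_circle_factor_bound.
Qed.

Lemma circle_mean0_lt1 b : cabs b < 1 -> circle_mean b = 0.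
Proof.
move=> b1; have iter_sqr n : cabs (b ^+ (2 ^ n)) <= cabs b.
  by rewrite cabsX ler_iXnr ?cabs_ge0 ?expn_gt0// ltW.
have meanE n : circle_mean (b ^+ (2 ^ n)) = 2 ^+ n * circle_mean b.
  elim: n => [|n IH]; first by rewrite expr0 mul1r.
  rewrite expnS mulnC exprM circle_mean_sqr ?IH ?mulrA -?exprS//.
  exact: le_lt_trans (iter_sqr n) b1.
pose C := 2 * pi * - ln (1 - cabs b).
have bound n : `|circle_mean b| <= C * 2^-1 ^+ n.
  rewrite exprVn ler_pdivlMr ?exprn_gt0// mulrC -(ger0_norm (exprn_ge0 n _))//.
  rewrite -normrM -meanE.
  have bn1 := le_lt_trans (iter_sqr n) b1.
  apply: le_trans (circle_mean_bound bn1) _.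
  rewrite ler_wpM2l ?mulr_ge0 ?pi_ge0// lerN2 ler_ln ?posrE ?subr_gt0//.
  by rewrite lerB.
have cvg0 : C * 2^-1 ^+ n @[n --> \oo] --> (0 : R).
  rewrite -(mulr0 C); apply: cvgMl_tmp; apply: cvg_expr.
  by rewrite ger0_norm// invf_lt1// ltr1n.
apply/eqP; rewrite -normr_le0 -[leRHS](cvg_lim _ cvg0)//.
by apply: limr_ge; [exact: cvgP cvg0|near=> n].
Unshelve. all: by end_near. Qed.

Lemma measurable_circle_factor b :
  measurable_fun period (fun t => cabs (1 - b * expi t)).
Proof.
apply: measurable_funTS; apply: continuous_measurable_fun.
exact: continuous_circle_factor.
Qed.

Lemma expi_fiber_subset z :
  period `&` [set t | expi t = z] `<=`
  [set acos (complex.Re z); 2 * pi - acos (complex.Re z)].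
Proof.
move=> t [/=]; rewrite in_itv/= => /andP[t0 t2pi] <- /=.
have [tpi|pit] := leP t pi; first by left; rewrite cosK// in_itv/= t0.
right => /=; have -> : cos t = cos (2 * pi - t).
  by rewrite mulr_natl -[RHS]cosN opprB -(cosD2pi (t - _)) subrK.
rewrite cosK ?subKr// in_itv/= subr_ge0 t2pi/=; lra.
Qed.

Lemma ae_circle_factor_gt0 b :
  {ae mu, forall t, period t -> 0 < cabs (1 - b * expi t)}.
Proof.
exists [set acos (complex.Re b^-1); 2 * pi - acos (complex.Re b^-1)]; split.
- exact: measurableU.
- apply: countable_lebesgue_measure0; apply: finite_set_countable.
  by rewrite finite_setU; split; exact: finite_set1.
move=> t /= /not_implyP[tP]; rewrite cabs_gt0 => /negP/negPn.
rewrite subr_eq0 => /eqP bt; apply: expi_fiber_subset; split => //=.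
have b0 : b != 0 by apply: contra_eq_neq bt => ->; rewrite mul0r oner_eq0.
by rewrite -[RHS]mulr1 bt mulKf.
Qed.

Lemma cabs_onem_scale (r : R) z : 0 < r -> cabs z = 1 ->
  cabs (1 - r%:C * z) ^+ 2 = r * (cabs (1 - z) ^+ 2 + (1 - r) ^+ 2 / r).
Proof.
move=> r0 z1; have := cabs_sqr z; rewrite z1 expr1n !cabs_sqr.
case: z {z1} => x y /= xy.
have yE : y ^+ 2 = 1 - x ^+ 2 by rewrite xy addrC addKr.
rewrite !mul0r !subr0 !addr0 !sub0r !sqrrN exprMn yE; field.
by rewrite gt_eqF.
Qed.

Lemma sqr_add_onem_sqr_div_gt0 (x r : R) : 0 < r < 1 ->
  0 < x ^+ 2 + (1 - r) ^+ 2 / r.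
Proof.
move=> /andP[r0 r1].
by rewrite ltr_wpDl ?sqr_ge0// divr_gt0// exprn_gt0// subr_gt0.
Qed.

Lemma ln_cabs_onem_scale (r : R) z : 0 < r < 1 -> cabs z = 1 ->
  ln (cabs (1 - r%:C * z)) - ln r / 2 =
  ln (cabs (1 - z) ^+ 2 + (1 - r) ^+ 2 / r) / 2.
Proof.
move=> r01 z1; have s0 := sqr_add_onem_sqr_div_gt0 (cabs (1 - z)) r01.
have /andP[r0 r1] := r01; have c0 : 0 < cabs (1 - r%:C * z).
  rewrite lt_neqAle cabs_ge0 andbT eq_sym -sqrf_eq0 cabs_onem_scale//.
  by rewrite gt_eqF// mulr_gt0.
have := cabs_onem_scale r0 z1 => /(congr1 (@ln R)).
by rewrite lnXn// lnM ?posrE// -mulr_natl => E; lra.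
Qed.

Lemma onem_sqr_div_le (r s : R) : 0 < r -> r <= s -> s <= 1 ->
  (1 - s) ^+ 2 / s <= (1 - r) ^+ 2 / r.
Proof.
move=> r0 rs s1; have s0 := lt_le_trans r0 rs.
rewrite ler_pM ?exprn_ge0 ?invr_ge0 ?subr_ge0 ?(ltW s0)//.
  by rewrite lerXn2r ?nnegrE ?subr_ge0 ?lerB// (le_trans rs).
by rewrite lef_pV2.
Qed.

Lemma ln_cabs_onem_scale_ni (r s : R) z : 0 < r -> r <= s -> s < 1 ->
  cabs z = 1 ->
  ln (cabs (1 - s%:C * z)) - ln s / 2 <= ln (cabs (1 - r%:C * z)) - ln r / 2.
Proof.
move=> r0 rs s1 z1; have s0 := lt_le_trans r0 rs.
have r1 := le_lt_trans rs s1.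
rewrite !ln_cabs_onem_scale ?s0 ?r0// ler_pM2r ?invr_gt0//.
rewrite ler_ln ?posrE ?sqr_add_onem_sqr_div_gt0 ?s0 ?r0// lerD2l.
by apply: onem_sqr_div_le => //; exact: ltW.
Qed.

Lemma cvg_ln_cabs_onem_scale (r : R^nat) z :
  (forall n, 0 < r n < 1) -> r n @[n --> \oo] --> (1 : R) ->
  cabs z = 1 -> 0 < cabs (1 - z) ->
  ln (cabs (1 - (r n)%:C * z)) - ln (r n) / 2 @[n --> \oo] -->
  ln (cabs (1 - z)).
Proof.
move=> r01 r1 z1 z0; under eq_fun do rewrite ln_cabs_onem_scale//.
have -> : ln (cabs (1 - z)) = ln (cabs (1 - z) ^+ 2 + (1 - 1) ^+ 2 / 1) / 2.
  by rewrite subrr expr0n mul0r addr0 lnXn// -[_ *+ 2]mulr_natr mulfK.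
apply: cvgMr_tmp; apply: continuous_cvg.
  by apply: continuous_ln; rewrite subrr expr0n mul0r addr0 exprn_gt0.
apply: cvgD; first exact: cvg_cst.
apply: cvgM; last by apply: cvgV => //; exact: oner_neq0.
have r1B : 1 - r n @[n --> \oo] --> (1 - 1 : R).
  by apply: cvgB; [exact: cvg_cst|exact: r1].
by rewrite expr2; under eq_fun do rewrite expr2; exact: cvgM.
Qed.

Lemma cvg_harmonicS : harmonic n.+1 @[n --> \oo] --> (0 : R).
Proof. by have := @cvg_harmonic R; rewrite -cvg_shiftS. Qed.

Let radius n : R := 1 - harmonic n.+1.

Let radius_bounds n : 0 < radius n < 1.
Proof. by rewrite subr_gt0 invf_lt1// ltr1n gtrBl invr_gt0 ltr0n. Qed.

Let radius_nd : nondecreasing_seq radius.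
Proof. by move=> m n mn; rewrite lerB// lef_pV2 ?posrE// ler_nat. Qed.

Let cvg_radius : radius n @[n --> \oo] --> (1 : R).
Proof.
rewrite -[X in _ --> X]subr0; apply: cvgB; first exact: cvg_cst.
exact: cvg_harmonicS.
Qed.

(* With [r] increasing to [1], the functions
   [ln (cabs (1 - r * b * expi t)) - ln r / 2] have mean [- ln r / 2], and
   they decrease to [ln (cabs (1 - b * expi t))]. *)
Lemma circle_mean0_eq1 b : cabs b = 1 ->
  mu.-integrable period (EFin \o (fun t => ln (cabs (1 - b * expi t)))) /\
  circle_mean b = 0.
Proof.
move=> b1.
have bt1 t : cabs (b * expi t) = 1 by rewrite cabsM b1 cabs_expi mulr1.
have rb1 n : cabs ((radius n)%:C * b) < 1.
  have /andP[r0 r1] := radius_bounds n.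
  by rewrite cabsM b1 mulr1 cabsE expr0n addr0 sqrtr_sqr gtr0_norm.
pose g n t := ln (cabs (1 - (radius n)%:C * b * expi t)) - ln (radius n) / 2.
have ig n := integrable_ln_circle_factor_lt1 (rb1 n).
have ic := lty_integrable_cst measurable_period lebesgue_measure_period_lty.
have mean_g n : \int[mu]_(t in period) g n t = - (pi * ln (radius n)).
  rewrite RintegralB; [|exact: measurable_period|exact: ig|exact: ic].
  by rewrite -/(circle_mean _) circle_mean0_lt1// Rintegral_period_cst; field.
apply: (nonincreasing_cvg_Rintegral measurable_period (g := g)).
- by move=> n; exact: (integrableB measurable_period (ig n) (ic _)).
- move=> t _ m n mn; rewrite /g -!mulrA; apply: ln_cabs_onem_scale_ni => //.
  + by have /andP[] := radius_bounds m.
  + exact: radius_nd.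
  + by have /andP[] := radius_bounds n.
- apply: measurableT_comp (measurable_circle_factor b); exact: measurable_ln.
- apply: (@filterS _ _ (ae_filter_ringOfSetsType mu) _ _ _
    (ae_circle_factor_gt0 b)) => t /[apply] bt0.
  rewrite /g; under eq_fun do rewrite -mulrA.
  exact: cvg_ln_cabs_onem_scale.
- under eq_fun do rewrite mean_g.
  rewrite -oppr0 -(mulr0 pi) -(ln1 R); apply: cvgN; apply: cvgMl_tmp.
  by apply: continuous_cvg cvg_radius; exact: continuous_ln.
Qed.

Lemma ln_integrable_circle_factor b : cabs b <= 1 ->
  ln_integrable mu period (fun t => cabs (1 - b * expi t)).
Proof.
move=> b1; split.
- exact: measurable_circle_factor.
- exact: ae_circle_factor_gt0.
- move: b1; rewrite le_eqVlt => /predU1P[/circle_mean0_eq1[]//|].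
  exact: integrable_ln_circle_factor_lt1.
Qed.

Lemma circle_mean0 b : cabs b <= 1 -> circle_mean b = 0.
Proof.
rewrite le_eqVlt => /predU1P[/circle_mean0_eq1[]//|].
exact: circle_mean0_lt1.
Qed.

(* [cabs (expi t * z - a)] is [cabs a * cabs (1 - z / a * expi t)], and also
   [cabs z * cabs (1 - (a / z)^* * expi t)]. *)
Lemma cabs_expi_factor z a : (a != 0) || (z != 0) ->
  exists2 b : R[i], cabs b <= 1 & forall t,
    cabs (expi t * z - a) = Num.max (cabs z) (cabs a) * cabs (1 - b * expi t).
Proof.
move=> az0; have [zla|alz] := leP (cabs z) (cabs a).
  have a0 : a != 0.
    case/orP: az0 => // z0.
    by rewrite -cabs_gt0 (lt_le_trans _ zla)// cabs_gt0.
  exists (z / a); first by rewrite cabsM cabsV ler_pdivrMr ?mul1r ?cabs_gt0.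
  by move=> t; rewrite -cabsM -cabsN; congr cabs; field.
have z0 : z != 0 by rewrite -cabs_gt0 (le_lt_trans (cabs_ge0 a)).
exists (a / z)^*%C.
  by rewrite cabs_conjc cabsM cabsV ler_pdivrMr ?mul1r ?cabs_gt0// ltW.
move=> t; have bJ : (1 - (a / z)^* * expi t)^*%C = 1 - a / z / expi t.
  by rewrite expiV rmorphB rmorph1 rmorphM/= conjcK.
rewrite -(cabs_conjc (1 - _)) bJ -[RHS]mul1r -(cabs_expi t) -!cabsM.
by congr cabs; field; rewrite expi_neq0.
Qed.

Lemma max_cabs_gt0 z a : (a != 0) || (z != 0) -> 0 < Num.max (cabs z) (cabs a).
Proof. by rewrite lt_max !cabs_gt0 orbC. Qed.

Lemma ln_integrable_period_cst (c : R) : 0 < c ->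
  ln_integrable mu period (fun=> c).
Proof.
apply: ln_integrable_cst; first exact: measurable_period.
exact: lebesgue_measure_period_lty.
Qed.

Lemma ln_integrable_circle z a : (a != 0) || (z != 0) ->
  ln_integrable mu period (fun t => cabs (expi t * z - a)).
Proof.
move=> az0; have [b b1 abE] := cabs_expi_factor az0.
rewrite (funext abE); apply: ln_integrableM; first exact: measurable_period.
  exact/ln_integrable_period_cst/max_cabs_gt0.
exact: ln_integrable_circle_factor.
Qed.

Lemma Rintegral_ln_circle z a :
  \int[mu]_(t in period) ln (cabs (expi t * z - a)) =
  2 * pi * ln (Num.max (cabs z) (cabs a)).
Proof.
have [az0|] := boolP ((a != 0) || (z != 0)); last first.
  rewrite negb_or !negbK => /andP[/eqP-> /eqP->].
  under eq_Rintegral do rewrite mulr0 subr0.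
  by rewrite Rintegral_period_cst cabs0 maxxx.
have [b b1 abE] := cabs_expi_factor az0.
under eq_Rintegral do rewrite abE.
rewrite Rintegral_lnM; first last.
- exact: ln_integrable_circle_factor.
- exact/ln_integrable_period_cst/max_cabs_gt0.
- exact: measurable_period.
by rewrite Rintegral_period_cst -/(circle_mean b) circle_mean0// addr0.
Qed.

Lemma integrable_ln_circle z a :
  mu.-integrable period (EFin \o (fun t => ln (cabs (expi t * z - a)))).
Proof.
have [az0|] := boolP ((a != 0) || (z != 0)).
  by have [_ _] := ln_integrable_circle az0.
rewrite negb_or !negbK => /andP[/eqP-> /eqP->].
rewrite (_ : (fun t => _) = cst (ln (cabs 0))).
  exact: (lty_integrable_cst measurable_period lebesgue_measure_period_lty).
by apply/funext => t; rewrite mulr0 subr0.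
Qed.

End CircleMean.

(** * Plane Lebesgue measure *)

Section TonelliProduct.
Context d1 d2 d3 (T1 : measurableType d1) (T2 : measurableType d2)
  (T3 : measurableType d3) (R : realType).
Variables (m1 : {sigma_finite_measure set T1 -> \bar R})
  (m2 : {sigma_finite_measure set T2 -> \bar R})
  (m3 : {sigma_finite_measure set T3 -> \bar R}).
Implicit Types f : T1 * (T2 * T3) -> \bar R.

(* [fubini_tonelli] does not apply directly: the canonical sigma-finite
   structure of [m2 \x m3] is only inferred for subprobabilities. *)
Lemma fubini_tonelli_prod f : measurable_fun setT f -> (forall p, 0 <= f p)%E ->
  (\int[m1]_x \int[(m2 \x m3)%E]_q f (x, q) =
   \int[(m2 \x m3)%E]_q \int[m1]_x f (x, q))%E.
Proof.
move=> mf f0.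
have mfA : measurable_fun setT
    (fun p : (T1 * T2) * T3 => f (p.1.1, (p.1.2, p.2))).
  apply: (measurableT_comp mf); apply: measurable_fun_pair.
    exact: measurableT_comp measurable_fst measurable_fst.
  apply: measurable_fun_pair; last exact: measurable_snd.
  exact: measurableT_comp measurable_snd measurable_fst.
transitivity (\int[m1]_x \int[m2]_y \int[m3]_z f (x, (y, z)))%E.
  apply: eq_integral => x _; rewrite fubini_tonelli1//.
  exact: (measurableT_comp mf (pair1_measurable x)).
rewrite (fubini_tonelli (fun p => \int[m3]_z f (p.1, (p.2, z)))%E) /=;
  first last.
- by move=> p; exact: integral_ge0.
- exact: measurable_fun_fubini_tonelli_F mfA (fun p => f0 _).
rewrite fubini_tonelli1//; last by move=> q; exact: integral_ge0.
- apply: eq_integral => y _; rewrite /fubini_F.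
  apply: (fubini_tonelli (fun p : T1 * T3 => f (p.1, (y, p.2)))) => //.
  apply: (measurableT_comp mf); apply: measurable_fun_pair.
    exact: measurable_fst.
  exact: (measurableT_comp (pair1_measurable y) measurable_snd).
- exact: measurable_fun_fubini_tonelli_G mf f0.
Qed.

Lemma fubini_tonelli_prod_on (D : set T1) f : measurable D ->
  measurable_fun setT f -> (forall p, 0 <= f p)%E ->
  (\int[m1]_(x in D) \int[(m2 \x m3)%E]_q f (x, q) =
   \int[(m2 \x m3)%E]_q \int[m1]_(x in D) f (x, q))%E.
Proof.
move=> mD mf f0; pose g := f \_ (D `*` setT).
have mDT : measurable (D `*` [set: T2 * T3]) by exact: measurableX.
have gE x q : g (x, q) = if x \in D then f (x, q) else 0%E.
  by rewrite /g patchE in_setX in_setT andbT.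
have mg : measurable_fun setT g.
  exact/(measurable_restrictT _ mDT)/measurable_funTS.
have g0 p : (0 <= g p)%E by rewrite /g patchE; case: ifP.
transitivity (\int[m1]_x \int[(m2 \x m3)%E]_q g (x, q))%E.
  rewrite integral_mkcond; apply: eq_integral => x _; rewrite patchE.
  by under [in RHS]eq_integral do rewrite gE; case: ifP; rewrite ?integral0.
rewrite fubini_tonelli_prod//; apply: eq_integral => q _.
rewrite [RHS]integral_mkcond.
by apply: eq_integral => x _; rewrite gE patchE.
Qed.

End TonelliProduct.

Section PlaneRotation.
Context {R : realType}.
Local Notation mu := (@lebesgue_measure R).
Local Notation TR := (measurableTypeR R).
Local Notation mu2 := (mu \x mu)%E.
Implicit Types (f : TR * TR -> \bar R) (k c s t : R) (z : R * R).

Lemma measurable_translation k :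
  measurable_fun [set: TR] ((fun x => x + k) : TR -> TR).
Proof. exact: measurable_funD. Qed.

Lemma lebesgue_measure_translation k (A : set TR) : measurable A ->
  mu ((fun x => x + k) @^-1` A) = mu A.
Proof.
have mk := measurable_translation k; move=> mA.
rewrite (@lebesgue_measure_unique R
  (pushforward mu (fun x : TR => (x + k : TR))) _ A)//.
move=> X [[a b] _ <-] /=; rewrite /pushforward.
have -> : (fun x => x + k) @^-1` `]a, b] = `]a - k, b - k]%classic.
  by apply/seteqP; split => x /=; rewrite !in_itv/= ltrBlDr lerBrDr.
rewrite !lebesgue_measure_itv/= !lte_fin ltrD2r; case: ifP => // _.
by rewrite -!EFinB; congr EFin; ring.
Qed.

Lemma ge0_integral_translation (f : TR -> \bar R) k :
  measurable_fun [set: TR] f -> (forall x, 0 <= f x)%E ->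
  (\int[mu]_x f (x + k)%R = \int[mu]_x f x)%E.
Proof.
move=> mf f0; have mk := measurable_translation k.
rewrite -[LHS](ge0_integral_pushforward mk mu measurableT mf)//.
by apply: eq_measure_integral => A mA _; exact: lebesgue_measure_translation.
Qed.

Definition shearx k z : R * R := (z.1 + k * z.2, z.2).
Definition sheary k z : R * R := (z.1, z.2 + k * z.1).
Definition rotate c s z : R * R := (c * z.1 - s * z.2, c * z.2 + s * z.1).

Lemma measurable_shearx k :
  measurable_fun [set: TR * TR] (shearx k : _ -> TR * TR).
Proof.
apply: measurable_fun_pair; last exact: measurable_snd.
by apply: measurable_funD => //; exact: measurable_funM.
Qed.

Lemma measurable_sheary k :
  measurable_fun [set: TR * TR] (sheary k : _ -> TR * TR).
Proof.
apply: measurable_fun_pair; first exact: measurable_fst.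
by apply: measurable_funD => //; exact: measurable_funM.
Qed.

Lemma measurable_rotate c s :
  measurable_fun [set: TR * TR] (rotate c s : _ -> TR * TR).
Proof.
apply: measurable_fun_pair.
  by apply: measurable_funB; exact: measurable_funM.
by apply: measurable_funD; exact: measurable_funM.
Qed.

Lemma rotate_shears c s z : s != 0 -> c ^+ 2 + s ^+ 2 = 1 ->
  let k := - ((1 - c) / s) in
  rotate c s z = shearx k (sheary s (shearx k z)).
Proof.
move=> s0 cs k; have sE : s = (1 - c ^+ 2) / s.
  by rewrite -cs addrC addKr expr2 mulfK.
case: z => x y; congr (_, _) => /=; last by rewrite /k; field.
by rewrite {1}sE /k; field.
Qed.

Lemma ge0_integral_shearx f k : measurable_fun [set: TR * TR] f ->
  (forall z, 0 <= f z)%E -> (\int[mu2]_z f (shearx k z) = \int[mu2]_z f z)%E.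
Proof.
move=> mf f0; rewrite !fubini_tonelli2//; last first.
  exact: measurableT_comp mf (measurable_shearx k).
apply: eq_integral => y _; rewrite /fubini_G /shearx/=.
apply: (ge0_integral_translation (f := fun x => f (x, y))) => //.
exact: measurableT_comp mf (pair2_measurable y).
Qed.

Lemma ge0_integral_sheary f k : measurable_fun [set: TR * TR] f ->
  (forall z, 0 <= f z)%E -> (\int[mu2]_z f (sheary k z) = \int[mu2]_z f z)%E.
Proof.
move=> mf f0; rewrite !fubini_tonelli1//; last first.
  exact: measurableT_comp mf (measurable_sheary k).
apply: eq_integral => x _; rewrite /fubini_F /sheary/=.
apply: (ge0_integral_translation (f := fun y => f (x, y))) => //.
exact: measurableT_comp mf (pair1_measurable x).
Qed.

Lemma ge0_integral_rotate_neq0 f c s : s != 0 -> c ^+ 2 + s ^+ 2 = 1 ->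
  measurable_fun [set: TR * TR] f -> (forall z, 0 <= f z)%E ->
  (\int[mu2]_z f (rotate c s z) = \int[mu2]_z f z)%E.
Proof.
move=> s0 cs mf f0; under eq_integral do rewrite rotate_shears//.
set k := - _; have mfx := measurableT_comp mf (measurable_shearx k).
have mfxy := measurableT_comp mfx (measurable_sheary s).
rewrite (ge0_integral_shearx (f := fun z => f (shearx k (sheary s z))))//.
rewrite (ge0_integral_sheary (f := fun z => f (shearx k z)))//.
exact: ge0_integral_shearx.
Qed.

Lemma ge0_integral_rotate f c s : c ^+ 2 + s ^+ 2 = 1 ->
  measurable_fun [set: TR * TR] f -> (forall z, 0 <= f z)%E ->
  (\int[mu2]_z f (rotate c s z) = \int[mu2]_z f z)%E.
Proof.
move=> cs mf f0; have [s0|s0] := eqVneq s 0; last first.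
  exact: ge0_integral_rotate_neq0.
move: cs; rewrite s0 expr0n addr0 => /eqP; rewrite sqrf_eq1 => /orP[]/eqP ->.
  apply: eq_integral => -[x y] _.
  by rewrite /rotate/= !mul1r !mul0r subr0 addr0.
have cs01 : 0 ^+ 2 + 1 ^+ 2 = 1 :> R by rewrite expr0n expr1n add0r.
have s1 := oner_neq0 R.
have mf_rot := measurableT_comp mf (measurable_rotate 0 1).
rewrite -(ge0_integral_rotate_neq0 s1 cs01 mf f0).
rewrite -(ge0_integral_rotate_neq0 s1 cs01 mf_rot (fun z => f0 _)).
by apply: eq_integral => -[x y] _; congr (f (_, _)); rewrite /=; ring.
Qed.

Local Notation period := (`[0, 2 * pi]%classic : set TR).

Lemma measurable_rotate_cos_sin :
  measurable_fun [set: TR * (TR * TR)]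
    ((fun p => rotate (cos p.1) (sin p.1) p.2) : _ -> TR * TR).
Proof.
have mc : measurable_fun setT (fun p : TR * (TR * TR) => cos p.1 : R).
  apply: (measurableT_comp _ measurable_fst).
  by apply: continuous_measurable_fun; exact: continuous_cos.
have ms : measurable_fun setT (fun p : TR * (TR * TR) => sin p.1 : R).
  apply: (measurableT_comp _ measurable_fst).
  by apply: continuous_measurable_fun; exact: continuous_sin.
have m1 : measurable_fun setT (fun p : TR * (TR * TR) => p.2.1 : R).
  exact: measurableT_comp measurable_fst measurable_snd.
have m2 : measurable_fun setT (fun p : TR * (TR * TR) => p.2.2 : R).
  exact: measurableT_comp measurable_snd measurable_snd.
apply: measurable_fun_pair.
  by apply: measurable_funB; exact: measurable_funM.
by apply: measurable_funD; exact: measurable_funM.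
Qed.

Lemma ge0_integral_rotation_mean f : measurable_fun [set: TR * TR] f ->
  (forall z, 0 <= f z)%E ->
  (\int[mu2]_z \int[mu]_(t in period) f (rotate (cos t) (sin t) z) =
   (\int[mu2]_z f z) * (2 * pi)%:E)%E.
Proof.
move=> mf f0; rewrite -(@fubini_tonelli_prod_on _ _ _ _ _ _ _ mu mu mu period
  (fun p => f (rotate (cos p.1) (sin p.1) p.2)))//; last first.
  exact: measurableT_comp mf measurable_rotate_cos_sin.
transitivity (\int[mu]_(t in period) cst (\int[mu2]_z f z) t)%E.
  by apply: eq_integral => t _; exact: ge0_integral_rotate (cos2Dsin2 t) mf f0.
by rewrite integral_cst// [X in (_ * X)%E]lebesgue_measure_period.
Qed.

Lemma ge0_integral_rotation_mean_on (D : set (TR * TR)) f :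
  (forall t z, D (rotate (cos t) (sin t) z) <-> D z) ->
  measurable D -> measurable_fun D f -> (forall z, D z -> 0 <= f z)%E ->
  (\int[mu2]_(z in D) \int[mu]_(t in period) f (rotate (cos t) (sin t) z) =
   (\int[mu2]_(z in D) f z) * (2 * pi)%:E)%E.
Proof.
move=> rotD mD mf f0; rewrite [in RHS]integral_mkcond.
rewrite -ge0_integral_rotation_mean; first last.
- by move=> z; rewrite patchE; case: ifPn => // /set_mem/f0.
- exact/(measurable_restrictT _ mD).
rewrite integral_mkcond; apply: eq_integral => z _; rewrite patchE.
case: ifPn => zD.
  apply: eq_integral => t _; rewrite patchE mem_set//.
  exact/rotD/set_mem.
rewrite integral0_eq// => t _; rewrite patchE memNset// => /rotD/mem_set.
by rewrite (negbTE zD).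
Qed.

End PlaneRotation.

Section RadialIntegral.
Context {R : realType}.
Local Notation mu := (@lebesgue_measure R).
Local Notation TR := (measurableTypeR R).
Local Notation mu2 := (mu \x mu)%E.
Implicit Types (c r s x : R).

Definition sqnorm (z : R * R) : R := z.1 ^+ 2 + z.2 ^+ 2.

Lemma sqnorm_ge0 z : 0 <= sqnorm z.
Proof. by rewrite addr_ge0 ?sqr_ge0. Qed.

Lemma measurable_sqnorm : measurable_fun [set: TR * TR] (sqnorm : _ -> TR).
Proof.
by apply: measurable_funD; apply: measurable_funX;
  [exact: measurable_fst|exact: measurable_snd].
Qed.

Lemma integral_sqr_cos c :
  (\int[mu]_(t in `[(- (pi / 2))%R, (pi / 2)%R]) (c * cos t ^+ 2)%:E =
   (c * pi / 2)%:E)%E.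
Proof.
have dF (t : R) : is_derive t 1 (fun t => c / 2 * (t + sin t * cos t))
    (c * cos t ^+ 2).
  apply: is_derive_eq; rewrite /GRing.scale/= mulrN -!expr2 sin2cos2.
  by field.
have pi2 : - (pi / 2) <= pi / 2 :> R by have := pi_gt0 R; lra.
rewrite (integral_is_derive pi2 (fun t _ => dF t)).
  by rewrite cosN cos_pihalf !mulr0 !addr0; congr EFin; field.
apply: continuous_subspaceT => t; apply: cvgMl_tmp.
exact: continuous_sqr (@continuous_cos R) t.
Qed.

Lemma integral_semicircle s : 0 < s ->
  (\int[mu]_(x in `[(- s)%R, s]) (2 * Num.sqrt (s ^+ 2 - x ^+ 2))%:E =
   (pi * s ^+ 2)%:E)%E.
Proof.
move=> s0; pose F (t : R) := s * sin t.
have dF (t : R) : is_derive t 1 F (s * cos t) by apply: is_derive_eq.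
have dFE : F^`()%classic = (fun t => s * cos t).
  by apply/funext => t; rewrite derive1E; have [_ ->] := dF t.
have cF t : {for t, continuous F} by exact: is_derive_continuous (dF t).
have cdF : continuous (F^`()%classic).
  by rewrite dFE => t; apply: cvgMl_tmp; exact: continuous_cos.
have pi2 : - (pi / 2) < pi / 2 :> R by have := pi_gt0 R; lra.
have -> : `[- s, s]%classic = `[F (- (pi / 2)), F (pi / 2)]%classic.
  by rewrite /F sinN sin_pihalf mulrN mulr1.
rewrite (integration_by_substitution_increasing (ltW pi2)); first last.
- apply: continuous_subspaceT => x; apply: cvgMl_tmp.
  apply: continuous_comp; last exact: sqrt_continuous.
  by apply: cvgB; [exact: cvg_cst|exact: exprn_continuous].
- split; first by move=> t _; have [] := dF t.
    exact/cvg_at_right_filter/cF.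
  exact/cvg_at_left_filter/cF.
- by apply: cvgP; apply: cvg_at_left_filter; exact: cdF.
- by apply: cvgP; apply: cvg_at_right_filter; exact: cdF.
- by move=> t _; exact: cdF.
- by move=> x y xpi ypi xy; rewrite ltr_pM2l// ltr_sin.
transitivity
  (\int[mu]_(t in `[(- (pi / 2))%R, (pi / 2)%R])
     (2 * s ^+ 2 * cos t ^+ 2)%:E)%E.
  apply: eq_integral => t; rewrite inE/= in_itv/= => tpi; congr EFin.
  rewrite fctE dFE /F/= exprMn -{1}[s ^+ 2]mulr1 -mulrBr -cos2sin2 -exprMn.
  rewrite sqrtr_sqr ger0_norm; first by ring.
  by rewrite mulr_ge0 ?(ltW s0)// cos_ge0_pihalf.
by rewrite integral_sqr_cos; congr EFin; field.
Qed.

Lemma xsection_disk r x :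
  xsection [set z : TR * TR | sqnorm z < r] x =
  `]- Num.sqrt (r - x ^+ 2), Num.sqrt (r - x ^+ 2)[%classic.
Proof.
apply/seteqP; split => y; rewrite /xsection/= inE/= /sqnorm/= -ltrBrDl;
  rewrite in_itv/= -ltr_norml -sqrtr_sqr.
  by move=> yrx; rewrite ltr_sqrt// (le_lt_trans _ yrx)// sqr_ge0.
have [rx|rx] := ltP 0 (r - x ^+ 2); first by rewrite ltr_sqrt.
by rewrite (ler0_sqrtr rx) ltNge sqrtr_ge0.
Qed.

Lemma measure_xsection_disk r x :
  mu (xsection [set z : TR * TR | sqnorm z < r] x) =
  (2 * Num.sqrt (r - x ^+ 2))%:E.
Proof.
rewrite xsection_disk lebesgue_measure_itv/= lte_fin -EFinB.
by have := sqrtr_ge0 (r - x ^+ 2); case: ltP => *; congr EFin; lra.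
Qed.

Lemma area_disk r :
  mu2 [set z : TR * TR | sqnorm z < r] = (pi * Num.max 0 r)%:E.
Proof.
rewrite /product_measure1/=; have [r0|r0] := leP r 0.
  rewrite mulr0 integral0_eq// => x _; rewrite measure_xsection_disk.
  by rewrite ler0_sqrtr ?mulr0// subr_le0 (le_trans r0)// sqr_ge0.
pose s := Num.sqrt r; have sE : s ^+ 2 = r by rewrite sqr_sqrtr// ltW.
have s0 : 0 < s by rewrite sqrtr_gt0.
rewrite -sE -(integral_semicircle s0) [RHS]integral_mkcond.
apply: eq_integral => x _; rewrite patchE mem_setE in_itv/= -ler_norml sE.
rewrite measure_xsection_disk; case: ifPn => //; rewrite -ltNge => sx.
rewrite ler0_sqrtr ?mulr0// subr_le0 -sE -(real_normK (num_real x)).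
by rewrite lerXn2r ?nnegrE// ltW.
Qed.

Lemma pushforward_sqnorm (A : set TR) : measurable A ->
  mu2 (sqnorm @^-1` A) = (pi%:E * mu (A `&` `[0%R, +oo[))%E.
Proof.
have msq := measurable_sqnorm.
have m0 : measurable (`[0%R, +oo[ : set TR) by exact: measurable_itv.
pose nu := mscale (NngNum (pi_ge0 R)) (mrestr mu m0).
move=> mA; rewrite -[RHS]/(nu A).
apply: (@measure_unique _ R TR (@RGenInftyO.G R) (fun n => `]-oo, n%:R[%classic)
  _ _ _ _ (pushforward mu2 (sqnorm : TR * TR -> TR)) nu) => //.
- exact: RGenInftyO.measurableE.
- move=> _ _ [x ->] [y ->]; exists (Num.min x y).
  by apply/seteqP; split => z /=; rewrite !in_itv/= lt_min => /andP.
- by move=> n; exists n%:R.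
- apply/seteqP; split => // x _; exists (Num.truncn x).+1 => //=.
  by rewrite in_itv/= truncnS_gt.
- move=> _ [r ->]; rewrite [LHS]area_disk EFinM.
  rewrite -[RHS]/(pi%:E * mu (`]-oo, r[ `&` `[0%R, +oo[))%E; congr (_ * _)%E.
  rewrite (_ : _ `&` _ = `[0, r[%classic).
    by rewrite lebesgue_measure_itv/= lte_fin; case: ltP; rewrite ?oppr0 ?adde0.
  apply/seteqP; split => x /=; rewrite !in_itv/= andbT.
    by move=> [-> ->].
  by move=> /andP[-> ->].
- by move=> n; rewrite [ltLHS]area_disk ltry.
Qed.

Lemma ge0_integral_radial (D : set TR) (f : TR -> \bar R) :
  measurable D -> D `<=` `[0, +oo[ -> measurable_fun D f ->
  (forall x, D x -> 0 <= f x)%E ->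
  (\int[mu2]_(z in sqnorm @^-1` D) f (sqnorm z) =
   pi%:E * \int[mu]_(x in D) f x)%E.
Proof.
move=> mD D0 mf f0.
have f0D : {in D, forall x, (0 <= f x)%E} by move=> x; rewrite inE; exact: f0.
rewrite -[LHS](ge0_integral_pushforward measurable_sqnorm mu2 mD mf f0D).
transitivity (\int[mscale (NngNum (pi_ge0 R)) mu]_(x in D) f x)%E; last first.
  exact: ge0_integral_mscale.
apply: eq_measure_integral => [|msq A mA AD]; first exact: measurable_sqnorm.
rewrite -[LHS]/(mu2 (sqnorm @^-1` A)) pushforward_sqnorm//.
by rewrite (setIidl (subset_trans AD D0)).
Qed.

End RadialIntegral.

(** * Logarithmic means over the unit disk *)

Section LnMaxSqrt.
Context {R : realType}.
Local Notation mu := (@lebesgue_measure R).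
Implicit Types (a x y : R).

Lemma ler_ln_ge1 x y : x <= y -> 1 <= y -> ln x <= ln y.
Proof.
move=> xy y1; have [x0|x0] := leP x 0; first by rewrite ln0// ln_ge0.
by rewrite ler_ln ?posrE// (lt_le_trans x0).
Qed.

(* The mean of [ln |z - w|] over the unit disk, for [|w| = a]. *)
Definition disk_mean a : R := if a < 1 then (a ^+ 2 - 1) / 2 else ln a.

Lemma lebesgue_measure_unit_itv (b c : bool) :
  mu [set` Interval (BSide b (0 : R)) (BSide c 1)] = 1%E.
Proof. by rewrite lebesgue_measure_itv/= lte_fin ltr01 oppr0 adde0. Qed.

Definition ln_max_sqrt a x : R := ln (Num.max (Num.sqrt x) a).

Lemma measurable_ln_max_sqrt a (D : set R) :
  measurable_fun (D : set (measurableTypeR R)) (ln_max_sqrt a).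
Proof.
apply: measurable_funTS; apply: measurableT_comp; first exact: measurable_ln.
apply: measurable_maxr; last exact: measurable_cst.
by apply: continuous_measurable_fun; exact: sqrt_continuous.
Qed.

Lemma continuous_ln_max_sqrt a : 0 < a -> continuous (ln_max_sqrt a).
Proof.
move=> a0 x; apply: continuous_comp; last first.
  by apply: continuous_ln; rewrite lt_max a0 orbT.
by apply: continuous_max; [exact: sqrt_continuous|exact: cst_continuous].
Qed.

Lemma is_derive_xlnx x : 0 < x ->
  is_derive x 1 (fun x => (x * ln x - x) / 2) (ln x / 2).
Proof.
move=> x0; have ? := is_derive1_ln x0.
apply: is_derive_eq; rewrite /GRing.scale/=; field.
by rewrite gt_eqF.
Qed.

Lemma integrable_ln_max_sqrt_gt0 a : 0 < a ->
  mu.-integrable `[0, 1] (EFin \o ln_max_sqrt a).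
Proof.
move=> a0; apply: continuous_itv_integrable; apply: continuous_subspaceT.
exact: continuous_ln_max_sqrt.
Qed.

Lemma Rintegral_ln_max_sqrt_ge1 a : 1 <= a ->
  \int[mu]_(x in `[0, 1]) ln_max_sqrt a x = ln a.
Proof.
move=> a1; transitivity (\int[mu]_(x in `[0, 1]) cst (ln a) x).
  apply: eq_Rintegral => x; rewrite inE/= in_itv/= => /andP[_ x1].
  rewrite /ln_max_sqrt; congr ln; apply/max_idPr; apply: le_trans a1.
  by rewrite -sqrtr1 ler_wsqrtr.
by rewrite Rintegral_cst//= lebesgue_measure_unit_itv mulr1.
Qed.

Lemma Rintegral_ln_max_sqrt_lt1 a : 0 < a < 1 ->
  \int[mu]_(x in `[0, 1]) ln_max_sqrt a x = (a ^+ 2 - 1) / 2.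
Proof.
move=> /andP[a0 a1]; have fi := integrable_ln_max_sqrt_gt0 a0.
have a20 : 0 < a ^+ 2 by rewrite exprn_gt0.
have a21 : a ^+ 2 < 1 by rewrite expr_lt1// ltW.
have lo : \int[mu]_(x in `[0, a ^+ 2]) ln_max_sqrt a x = ln a * a ^+ 2.
  transitivity (\int[mu]_(x in `[0, a ^+ 2]) cst (ln a) x).
    apply: eq_Rintegral => x; rewrite inE/= in_itv/= => /andP[_ xa].
    rewrite /ln_max_sqrt; congr ln; apply/max_idPr.
    by rewrite -(ger0_norm (ltW a0)) -sqrtr_sqr ler_wsqrtr.
  by rewrite Rintegral_cst//= lebesgue_measure_itv/= lte_fin a20 oppr0 adde0.
have hi : \int[mu]_(x in `[a ^+ 2, 1]) ln_max_sqrt a x =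
    (1 * ln 1 - 1) / 2 - (a ^+ 2 * ln (a ^+ 2) - a ^+ 2) / 2.
  transitivity (\int[mu]_(x in `[a ^+ 2, 1]) (ln x / 2)).
    apply: eq_Rintegral => x; rewrite inE/= in_itv/= => /andP[ax _].
    have x0 : 0 < x by exact: lt_le_trans ax.
    rewrite /ln_max_sqrt (max_idPl _); last first.
      by rewrite -(ger0_norm (ltW a0)) -sqrtr_sqr ler_wsqrtr.
    rewrite -[in RHS](sqr_sqrtr (ltW x0)) lnXn ?sqrtr_gt0//.
    by rewrite -[_ *+ 2]mulr_natr mulfK.
  have d x (ax : a ^+ 2 <= x <= 1) :=
    is_derive_xlnx (lt_le_trans a20 (andP ax).1).
  apply: (Rintegral_is_derive (ltW a21) d).
  apply: continuous_in_subspaceT => x; rewrite inE/= in_itv/= => /andP[ax _].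
  by apply: cvgMr_tmp; apply: continuous_ln; exact: lt_le_trans ax.
have := Rintegral_itvB fi (x := a ^+ 2).
rewrite !bnd_simp (ltW a20) (ltW a21) Rintegral_itv_obnd_cbnd; last first.
  by apply: integrableS fi => //; apply: subset_itvr; rewrite bnd_simp ltW.
move=> /(_ isT isT)/eqP; rewrite subr_eq => /eqP ->.
by rewrite lo hi lnXn// ln1 -[_ *+ 2]mulr_natr; field.
Qed.

Lemma Rintegral_ln_max_sqrt_gt0 a : 0 < a ->
  \int[mu]_(x in `[0, 1]) ln_max_sqrt a x = disk_mean a.
Proof.
move=> a0; rewrite /disk_mean; case: ltP => a1.
  by rewrite Rintegral_ln_max_sqrt_lt1// a0.
exact: Rintegral_ln_max_sqrt_ge1.
Qed.

Lemma integral_ln_max_sqrt0 :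
  mu.-integrable `[0, 1] (EFin \o ln_max_sqrt 0) /\
  \int[mu]_(x in `[0, 1]) ln_max_sqrt 0 x = disk_mean 0.
Proof.
have h0 n : 0 < harmonic n.+1 :> R by rewrite invr_gt0.
have cvgh := @cvg_harmonicS R.
apply: (@nonincreasing_cvg_Rintegral _ _ R mu `[0, 1]%classic (measurable_itv _)
  (fun n => ln_max_sqrt (harmonic n.+1))).
- by move=> n; exact: integrable_ln_max_sqrt_gt0.
- move=> x _ m n mn; rewrite ler_ln ?posrE ?lt_max ?h0 ?orbT//.
  have hmn : harmonic n.+1 <= harmonic m.+1 :> R.
    by rewrite lef_pV2 ?posrE// ler_nat.
  by rewrite ge_max !le_max lexx hmn orbT.
- exact: measurable_ln_max_sqrt.
- exists [set 0]; split => //; first exact: lebesgue_measure_set1.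
  move=> x /= /not_implyP[]; rewrite in_itv/= => /andP[x0 _] nlim.
  apply: contrapT => /eqP xn0.
  apply: nlim; apply: (@continuous_cvg _ _ _ _ _ _ (ln_max_sqrt ^~ x) 0 _ cvgh).
  apply: continuous_comp.
    by apply: continuous_max; [exact: cst_continuous|exact: cvg_id].
  by apply: continuous_ln; rewrite lt_max sqrtr_gt0 lt_neqAle x0 eq_sym xn0.
- under eq_fun do rewrite Rintegral_ln_max_sqrt_gt0//.
  have -> : (fun n => disk_mean (harmonic n.+1)) =
      (fun n => (harmonic n.+1 * harmonic n.+1 - 1) / 2).
    by apply/funext => n; rewrite /disk_mean invf_lt1// ltr1n.
  rewrite /disk_mean ltr01 expr2; apply: cvgMr_tmp.
  by apply: cvgB; [exact: cvgM|exact: cvg_cst].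
Qed.

Lemma integrable_ln_max_sqrt a : 0 <= a ->
  mu.-integrable `[0, 1] (EFin \o ln_max_sqrt a).
Proof.
rewrite le_eqVlt => /predU1P[<-|]; first by case: integral_ln_max_sqrt0.
exact: integrable_ln_max_sqrt_gt0.
Qed.

Lemma Rintegral_ln_max_sqrt a : 0 <= a ->
  \int[mu]_(x in `[0, 1]) ln_max_sqrt a x = disk_mean a.
Proof.
rewrite le_eqVlt => /predU1P[<-|]; first by case: integral_ln_max_sqrt0.
exact: Rintegral_ln_max_sqrt_gt0.
Qed.

End LnMaxSqrt.

Section UnitDisk.
Context {R : realType}.
Local Notation mu := (@lebesgue_measure R).
Local Notation TR := (measurableTypeR R).
Local Notation mu2 := (mu \x mu)%E.
Local Notation disk := (unit_disk R : set (TR * TR)).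
Local Notation period := (`[0, 2 * pi]%classic : set TR).
Implicit Types (w a : R[i]) (z : R * R) (t c : R).

Definition complex_of_pair z : R[i] := z.1 +i* z.2.

Lemma complex_of_pair_rotate t z :
  complex_of_pair (rotate (cos t) (sin t) z) = expi t * complex_of_pair z.
Proof. by []. Qed.

Lemma cabs_complex_of_pair z : cabs (complex_of_pair z) = Num.sqrt (sqnorm z).
Proof. by []. Qed.

Lemma unit_disk_sqnorm : disk = sqnorm @^-1` `[0, 1[.
Proof.
have cabs_lt1 z : (cabs (complex_of_pair z) < 1) = (0 <= sqnorm z < 1).
  by rewrite cabs_complex_of_pair -[X in _ < X]sqrtr1 ltr_sqrt// sqnorm_ge0.
apply/seteqP; split => z; rewrite /preimage/= in_itv/= -cabs_lt1; exact.
Qed.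

Lemma measurable_unit_disk : measurable disk.
Proof.
by rewrite unit_disk_sqnorm -[X in measurable X]setTI; exact: measurable_sqnorm.
Qed.

Lemma area_unit_disk : mu2 disk = pi%:E.
Proof.
rewrite unit_disk_sqnorm [LHS]pushforward_sqnorm//.
rewrite setIidl; last by apply: subset_itvl.
by rewrite [X in (_ * X)%E]lebesgue_measure_unit_itv mule1.
Qed.

Lemma area_unit_disk_lty : (mu2 disk < +oo)%E.
Proof. by rewrite area_unit_disk ltry. Qed.

Lemma rotate_unit_disk t z : disk (rotate (cos t) (sin t) z) <-> disk z.
Proof.
have diskE u : disk u = (cabs (complex_of_pair u) < 1) :> Prop by [].
by rewrite !diskE complex_of_pair_rotate cabsM cabs_expi mul1r.
Qed.

Lemma measurable_cabs_sub a :
  measurable_fun [set: TR * TR] (fun z => cabs (complex_of_pair z - a) : TR).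
Proof.
case: a => [x y]; apply: (measurableT_comp (f := @Num.sqrt R)).
  by apply: continuous_measurable_fun; exact: sqrt_continuous.
by apply: measurable_funD; apply: measurable_funX; exact: measurable_funB.
Qed.

Lemma integral_disk_radial (b c : R) : 0 <= b ->
  (forall x, 0 <= x < 1 -> ln_max_sqrt b x <= c) ->
  (\int[mu2]_(z in disk) (c - ln (Num.max (cabs (complex_of_pair z)) b))%:E =
   (pi * (c - disk_mean b))%:E)%E.
Proof.
move=> b0 lnc; rewrite unit_disk_sqnorm.
rewrite (ge0_integral_radial (f := fun x => (c - ln_max_sqrt b x)%:E))//.
- rewrite integral_itv_bndo_bndc; last first.
    apply/measurable_EFinP/measurable_funB; first exact: measurable_cst.
    exact: measurable_ln_max_sqrt.
  rewrite integral_cstB//; last exact: integrable_ln_max_sqrt.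
    rewrite Rintegral_ln_max_sqrt// [X in fine X]lebesgue_measure_unit_itv.
    by rewrite mulr1 EFinM.
  by rewrite [ltLHS]lebesgue_measure_unit_itv ltry.
- exact: subset_itvl.
- apply/measurable_EFinP/measurable_funB; first exact: measurable_cst.
  exact: measurable_ln_max_sqrt.
- by move=> x; rewrite /= in_itv/= lee_fin subr_ge0; exact: lnc.
Qed.

(* On the disk [ln |z - a|] is at most [ln (1 + |a|)]: Tonelli's theorem
   applies to the difference. *)
Definition ln_gap a z : \bar R :=
  (ln (1 + cabs a) - ln (cabs (complex_of_pair z - a)))%:E.

Lemma ln_gap_ge0 a z : disk z -> (0 <= ln_gap a z)%E.
Proof.
move=> z1; rewrite lee_fin subr_ge0 ler_ln_ge1 ?lerDl ?cabs_ge0//.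
by rewrite (le_trans (ler_cabsB _ _))// lerD2r ltW.
Qed.

Lemma measurable_ln_gap a (D : set (TR * TR)) : measurable_fun D (ln_gap a).
Proof.
apply/measurable_funTS/measurable_EFinP/measurable_funB => //.
by apply: measurableT_comp; [exact: measurable_ln|exact: measurable_cabs_sub].
Qed.

Lemma circle_integral_ln_gap a z :
  (\int[mu]_(t in period) ln_gap a (rotate (cos t) (sin t) z) =
   (2 * pi)%:E * (ln (1 + cabs a) -
     ln (Num.max (cabs (complex_of_pair z)) (cabs a)))%:E)%E.
Proof.
rewrite /ln_gap; under eq_integral do rewrite complex_of_pair_rotate.
rewrite (integral_cstB measurable_period lebesgue_measure_period_lty).
  rewrite Rintegral_ln_circle [X in fine X]lebesgue_measure_period -EFinM.
  by congr EFin; rewrite /=; ring.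
exact: integrable_ln_circle.
Qed.

(* Averaging over rotations replaces [ln |z - a|] by its mean over the circle
   through [z], which is radial. *)
Lemma integral_disk_ln_gap a : (\int[mu2]_(z in disk) ln_gap a z =
  (pi * (ln (1 + cabs a) - disk_mean (cabs a)))%:E)%E.
Proof.
have a0 := cabs_ge0 a; have a1 : 1 <= 1 + cabs a by rewrite lerDl.
have max_le x : x <= 1 -> Num.max x (cabs a) <= 1 + cabs a.
  by move=> x1; rewrite ge_max lerDr ler01 andbT ler_wpDr.
have mean_gap := ge0_integral_rotation_mean_on rotate_unit_disk
  measurable_unit_disk (@measurable_ln_gap a disk) (@ln_gap_ge0 a).
have pi20 : 2 * pi != 0 :> R by rewrite mulf_neq0// gt_eqF ?pi_gt0.
rewrite -[LHS]mule1 -(divff pi20) EFinM muleA -mean_gap.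
under eq_integral do rewrite circle_integral_ln_gap.
rewrite ge0_integralZl//; first last.
- by rewrite lee_fin mulr_ge0 ?pi_ge0.
- by move=> z z1; rewrite lee_fin subr_ge0 ler_ln_ge1// max_le// ltW.
- apply/measurable_funTS/measurable_EFinP/measurable_funB => //.
  apply: measurableT_comp; first exact: measurable_ln.
  apply: measurable_maxr => //.
  by have := measurable_cabs_sub 0; under eq_fun do rewrite subr0.
- exact: measurable_unit_disk.
rewrite integral_disk_radial// -?EFinM; first by rewrite mulrAC mulfV ?mul1r.
move=> x /andP[_ x1]; rewrite ler_ln_ge1// max_le//.
by rewrite -sqrtr1 ler_wsqrtr// ltW.
Qed.

Lemma integrable_Rintegral_ln_disk a :
  mu2.-integrable disk (EFin \o (fun z => ln (cabs (complex_of_pair z - a)))) /\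
  \int[mu2]_(z in disk) ln (cabs (complex_of_pair z - a)) =
  pi * disk_mean (cabs a).
Proof.
have mln : measurable_fun disk (fun z => ln (cabs (complex_of_pair z - a))).
  apply/measurable_funTS/measurableT_comp; first exact: measurable_ln.
  exact: measurable_cabs_sub.
have ln_le z : disk z ->
    ln (cabs (complex_of_pair z - a)) <= ln (1 + cabs a).
  by move=> /(@ln_gap_ge0 a); rewrite lee_fin subr_ge0.
have [ih ->] := integrable_ub measurable_unit_disk area_unit_disk_lty mln
  ln_le (integral_disk_ln_gap a).
by split => //; rewrite [X in fine X]area_unit_disk /=; ring.
Qed.

Lemma ae_cabs_sub_gt0 a :
  {ae mu2, forall z, disk z -> 0 < cabs (complex_of_pair z - a)}.
Proof.
exists ([set complex.Re a] `*` [set complex.Im a]); split.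
- exact: measurableX.
- have m1 (x : R) : measurable ([set x] : set TR) by exact: measurable_set1.
  apply: etrans (product_measure1E mu mu (m1 _) (m1 _)) _.
  by rewrite [X in (X * _)%E]lebesgue_measure_set1 mul0e.
move=> z /= /not_implyP[_]; rewrite cabs_gt0 => /negP/negPn; rewrite subr_eq0.
by move=> /eqP <-.
Qed.

Lemma ln_integrable_disk a :
  ln_integrable mu2 disk (fun z => cabs (complex_of_pair z - a)).
Proof.
split; last by have [] := integrable_Rintegral_ln_disk a.
  by apply: measurable_funTS; exact: measurable_cabs_sub.
exact: ae_cabs_sub_gt0.
Qed.

Lemma Rintegral_ln_disk a :
  \int[mu2]_(z in disk) ln (cabs (complex_of_pair z - a)) =
  pi * disk_mean (cabs a).
Proof. by have [] := integrable_Rintegral_ln_disk a. Qed.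

End UnitDisk.

(** * Jensen's formula *)

Section Jensen.
Context {R : realType}.
Local Notation mu := (@lebesgue_measure R).
Local Notation TR := (measurableTypeR R).
Local Notation mu2 := (mu \x mu)%E.
Local Notation disk := (unit_disk R : set (TR * TR)).
Local Notation period := (`[0, 2 * pi]%classic : set TR).
Implicit Types (P : {poly R[i]}) (z a : R[i]).

Definition roots P : seq R[i] := sval (closed_field_poly_normal P).

Lemma cabs_horner P z :
  cabs P.[z] = cabs (lead_coef P) * \prod_(a <- roots P) cabs (z - a).
Proof.
rewrite {1}(svalP (closed_field_poly_normal P)) hornerZ horner_prod.
rewrite cabsM cabs_prod.
by congr (_ * _); apply: eq_bigr => a _; rewrite hornerXsubC.
Qed.

Lemma Rintegral_ln_cabs_horner d (T : measurableType d)
    (m : {measure set T -> \bar R}) (D : set T) (f : T -> R[i]) P :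
  measurable D -> (m D < +oo)%E -> P != 0 ->
  (forall a, ln_integrable m D (fun x => cabs (f x - a))) ->
  \int[m]_(x in D) ln (cabs P.[f x]) =
  ln (cabs (lead_coef P)) * fine (m D) +
  \sum_(a <- roots P) \int[m]_(x in D) ln (cabs (f x - a)).
Proof.
move=> mD Doo P0 fa; under eq_Rintegral do rewrite cabs_horner.
rewrite Rintegral_lnM//; first by rewrite Rintegral_cst// Rintegral_ln_prod.
- by apply: ln_integrable_cst; rewrite // cabs_gt0 lead_coef_eq0.
- exact: ln_integrable_prod.
Qed.

Lemma log_mahlerE P : P != 0 ->
  log_mahler P = ln (cabs (lead_coef P)) +
    \sum_(a <- roots P) ln (Num.max 1 (cabs a)).
Proof.
move=> P0; have pi20 : 2 * pi != 0 :> R by rewrite mulf_neq0// gt_eqF ?pi_gt0.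
rewrite -[LHS]/((2 * pi)^-1 * \int[mu]_(t in period) ln (cabs P.[expi t])).
rewrite (Rintegral_ln_cabs_horner measurable_period)//.
- rewrite [X in fine X]lebesgue_measure_period/= mulrDr mulrCA mulVf// mulr1.
  rewrite mulr_sumr; congr (_ + _); apply: eq_bigr => a _.
  under eq_Rintegral do rewrite -[expi _]mulr1.
  by rewrite Rintegral_ln_circle cabs1 mulKf.
- exact: lebesgue_measure_period_lty.
- move=> a; rewrite (_ : (fun t => _) = fun t => cabs (expi t * 1 - a)).
    by apply: ln_integrable_circle; rewrite oner_neq0 orbT.
  by apply/funext => t; rewrite mulr1.
Qed.

Lemma log_areal_mahlerE P : P != 0 ->
  log_areal_mahler P = ln (cabs (lead_coef P)) +
    \sum_(a <- roots P) disk_mean (cabs a).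
Proof.
move=> P0; have pi0 : pi != 0 :> R by rewrite gt_eqF ?pi_gt0.
rewrite -[LHS]/(pi^-1 *
  \int[mu2]_(z in disk) ln (cabs P.[complex_of_pair z])).
rewrite (Rintegral_ln_cabs_horner measurable_unit_disk)//.
- rewrite [X in fine X]area_unit_disk/= mulrDr mulrCA mulVf// mulr1.
  rewrite mulr_sumr; congr (_ + _); apply: eq_bigr => a _.
  by rewrite Rintegral_ln_disk mulKf.
- exact: area_unit_disk_lty.
- exact: ln_integrable_disk.
Qed.

Lemma ln_prod (I : eqType) (s : seq I) (F : I -> R) :
  (forall i, i \in s -> 0 < F i) ->
  ln (\prod_(i <- s) F i) = \sum_(i <- s) ln (F i).
Proof.
elim: s => [|i s IH] F0; first by rewrite !big_nil ln1.
have Fs j : j \in s -> 0 < F j by move=> js; rewrite F0// in_cons js orbT.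
rewrite !big_cons lnM ?posrE ?F0 ?mem_head ?IH//.
by rewrite big_seq prodr_gt0.
Qed.

Lemma horner0_neq0 P : P.[0] != 0 -> P != 0.
Proof. by apply: contraNneq => ->; rewrite horner0. Qed.

Lemma cabs_root_gt0 P a : P.[0] != 0 -> a \in roots P -> 0 < cabs a.
Proof.
move=> P0 aP; rewrite cabs_gt0; apply: contraNneq P0 => a0.
by rewrite -cabs_eq0 cabs_horner (big_rem a)//= a0 subr0 cabs0 mul0r mulr0.
Qed.

Lemma ln_cabs_lead_coef P : cabs P.[0] = 1 ->
  ln (cabs (lead_coef P)) = - \sum_(a <- roots P) ln (cabs a).
Proof.
move=> P1; have P0 : P.[0] != 0 by rewrite -cabs_gt0 P1.
have a0 a : a \in roots P -> 0 < cabs a by exact: cabs_root_gt0.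
have : ln (cabs P.[0]) = 0 by rewrite P1 ln1.
rewrite cabs_horner; under eq_bigr do rewrite sub0r cabsN.
rewrite lnM ?posrE ?cabs_gt0 ?lead_coef_eq0 ?horner0_neq0//.
  by rewrite ln_prod// => /eqP; rewrite addr_eq0 => /eqP.
by rewrite big_seq prodr_gt0.
Qed.

Definition disk_roots P : seq R[i] := [seq a <- roots P | cabs a < 1].

Lemma nroots_diskE P : nroots_disk P = size (disk_roots P).
Proof. by rewrite size_filter. Qed.

Lemma log_mahler_disk_roots P : cabs P.[0] = 1 ->
  log_mahler P = \sum_(a <- disk_roots P) - ln (cabs a).
Proof.
move=> P1; have P0 : P.[0] != 0 by rewrite -cabs_gt0 P1.
rewrite log_mahlerE ?horner0_neq0// ln_cabs_lead_coef// addrC -sumrB.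
rewrite big_filter [RHS]big_mkcond; apply: eq_bigr => a _.
by case: ltP => a1; rewrite ?subrr// ln1 sub0r.
Qed.

Lemma log_areal_mahler_disk_roots P : cabs P.[0] = 1 ->
  log_areal_mahler P = \sum_(a <- disk_roots P) areal_part (- ln (cabs a)).
Proof.
move=> P1; have P0 : P.[0] != 0 by rewrite -cabs_gt0 P1.
rewrite log_areal_mahlerE ?horner0_neq0// ln_cabs_lead_coef// addrC -sumrB.
rewrite big_filter [RHS]big_mkcond big_seq [RHS]big_seq.
apply: eq_bigr => a aP; rewrite /disk_mean; case: ifP => a1; last exact: subrr.
rewrite /areal_part expRN2 opprK lnK ?posrE ?(cabs_root_gt0 P0)//.
by field.
Qed.

End Jensen.

Unset Implicit Arguments.

Theorem theorem1p2 (R : realType) (P : {poly R[i]})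
    (hP0 : cabs P.[0] = 1)
    (hareal : areal_mahler P < expR 1)
    (hZ : (1 <= nroots_disk P)%N) :
  let L := ln (areal_mahler P) in
  let S := fun n : nat =>
    \sum_(1 <= k < n) areal_coef R k * L `^ (k%:R / 2) in
  cvgn S /\
  ln (mahler P) ^+ 2 / (nroots_disk P)%:R <= L * (1 + limn S).
Proof.
move=> L S; pose u (a : R[i]) := - ln (cabs a).
have u0 a : a \in disk_roots P -> 0 <= u a.
  by rewrite mem_filter => /andP[a1 _]; rewrite oppr_ge0 ln_le0// ltW.
have LE : L = \sum_(a <- disk_roots P) areal_part (u a).
  by rewrite /L expRK log_areal_mahler_disk_roots.
have L0 : 0 <= L.
  by rewrite LE big_seq sumr_ge0// => a /u0; exact: areal_part_ge0.
have L1 : L < 1 by move: hareal; rewrite ltr_expR /L expRK.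
have SE : S = areal_sum (Num.sqrt L).
  apply/funext => n; apply: eq_bigr => k _; congr (_ * _).
  by rewrite mulrC powRrM powR12_sqrt// powR_mulrn// sqrtr_ge0.
rewrite SE; split.
  by apply: is_cvg_areal_sum; rewrite sqrtr_ge0 -sqrtr1 ltr_sqrt.
rewrite expRK log_mahler_disk_roots// nroots_diskE LE.
by apply: sqr_sum_le_areal_sum => //; rewrite -?nroots_diskE -?LE.
Qed.
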